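(* Let $\dots\xrightarrow{p_1}X_1\xrightarrow{p_0}X_0$ be a convergent inverse sequence of uniformly continuous maps between complete uniform ANRs, each $X_i$ being equipped with a metric inducing its uniformity, and let $X$ be its inverse limit. Then there exists a sequence of numbers $\alpha_i^*>0$ such that for each sequence of $\alpha_i\in(0,\alpha_i^*]$ the following are equivalent: (a) $X$ is a uniform ANR; (b) for each $i$ there exists a $j\ge i$ such that for each $k>j$ there exist an $l\ge k$ and a uniformly continuous map $s_i\colon X_j\to X_k$ such that the composition $X_j\xrightarrow{s_i}X_k\xrightarrow{p^k_i}X_i$ is $\alpha_i$-close to $p^j_i$, and $p^l_k$ is uniformly homotopic to the composition $X_l\xrightarrow{p^l_j}X_j\xrightarrow{s_i}X_k$ by a homotopy $h_i\colon X_l\times[0,1]\to X_k$ such that the composition $X_l\times[0,1]\xrightarrow{h_i}X_k\xrightarrow{p^k_i}X_i$ is $\alpha_i$-close to the motionless homotopy of $p^l_i$, i.e. to the map $(x,t)\mapsto p^l_i(x)$.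
   Context: A uniform ANR is a metrizable uniform space $Y$ such that for every uniform embedding $i$ of $Y$ onto a closed subspace of a metrizable uniform space $Z$ there exists a uniformly continuous retraction onto $i(Y)$ of some uniform neighborhood of $i(Y)$ in $Z$. A uniform neighborhood of a subset $S$ of a metrizable uniform space is a set containing an $\varepsilon$-neighborhood of $S$ for some $\varepsilon>0$. $p^j_i\colon X_j\to X_i$ ($j\ge i$) denotes the composite bonding map, and $p^\infty_i\colon X\to X_i$ the projection; $X$ is the subspace of threads in $\prod X_i$ with the product uniformity. Two maps into a metric space are $\alpha$-close if their values at each point are at distance at most $\alpha$. A uniform homotopy is a uniformly continuous homotopy. Let $X_{\mathbb{N}\cup\infty}$ be the inverse limit of the finite disjoint unions $X_n\sqcup\dots\sqcup X_0$ with bonding maps $X_{n+1}\sqcup X_n\sqcup\dots\sqcup X_0\to X_n\sqcup\dots\sqcup X_0$ equal to $p_n$ on $X_{n+1}$ and to the identity on $X_n\sqcup\dots\sqcup X_0$; it contains $X$ and each $X_i$. The inverse sequence is convergent if every uniform neighborhood of $X$ in $X_{\mathbb{N}\cup\infty}$ contains all but finitely many of the $X_i$'s. Equivalently: for each $i$, each uniform neighborhood of $p^\infty_i(X)$ in $X_i$ contains $p^j_i(X_j)$ for all but finitely many $j$. *)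

(* Defs.v *)
From HB Require Import structures.
From mathcomp Require Import all_boot all_order all_algebra.
From mathcomp Require Import all_classical all_reals.
From mathcomp Require Import topology.

Set Implicit Arguments.
Unset Strict Implicit.
Unset Printing Implicit Defensive.

Import Order.TTheory GRing.Theory Num.Theory.
Import numFieldTopology.Exports.

Local Open Scope classical_set_scope.
Local Open Scope ring_scope.

Definition is_metric (R : realType) (T : Type) (d : T -> T -> R) : Prop :=
  [/\ forall x, d x x = 0,
      forall x y, d x y = 0 -> x = y,
      forall x y, d x y = d y x
    & forall x y z, d x z <= d x y + d y z].

Definition compatible_metric (R : realType) (T : uniformType)
    (d : T -> T -> R) : Prop :=
  is_metric d /\ entourage = entourage_ (fun x e => [set y | d x y < e]).

Definition metrizable (R : realType) (T : uniformType) : Prop :=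
  exists d : T -> T -> R, compatible_metric d.

(* For a metrizable [T] the choice of the compatible metric is immaterial. *)
Definition uniform_nbhd (R : realType) (T : uniformType) (S N : set T) : Prop :=
  exists2 d : T -> T -> R, compatible_metric d &
    exists2 e : R, 0 < e & forall x y, S x -> d x y < e -> N y.

(* The last clause: the inverse is uniformly continuous on the image. *)
Definition uniform_embedding (Y Z : uniformType) (f : Y -> Z) : Prop :=
  [/\ injective f, unif_continuous f
    & forall E : set (Y * Y), entourage E ->
        exists2 F : set (Z * Z), entourage F &
          forall x y, F (f x, f y) -> E (x, y)].

Definition uniform_ANR (R : realType) (Y : uniformType) : Prop :=
  metrizable R Y /\
  forall (Z : uniformType) (f : Y -> Z),
    metrizable R Z -> uniform_embedding f -> closed (range f) ->
    exists2 N : set Z, uniform_nbhd R (range f) N &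
      exists r : N -> Z,
        [/\ unif_continuous r,
            forall u : N, range f (r u)
          & forall u : N, range f (val u) -> r u = val u].

(* The library's [completeType] is pointed; the spaces here may be empty. *)
Definition complete_uniform (T : uniformType) : Prop :=
  forall F : set_system T, ProperFilter F -> cauchy F ->
    exists x : T, F --> x.

Section inverse_sequence.
Variables (X : nat -> uniformType) (p : forall n, X n.+1 -> X n).

Fixpoint bond_add (i k : nat) : X (k + i) -> X i :=
  match k with
  | 0 => fun x => x
  | k'.+1 => fun x => bond_add (p x)
  end.

(* p^j_i : X_j -> X_i *)
Definition bond (i j : nat) (le_ij : (i <= j)%N) (x : X j) : X i :=
  bond_add (ecast n (X n) (esym (subnK le_ij)) x).

Definition threads : set (prod_topology X) :=
  [set x : prod_topology X | forall n, p (x n.+1) = x n].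

(* The set type of threads carries the uniformity induced from the product
   uniformity. *)
Definition inv_lim : uniformType := set_type threads.

End inverse_sequence.

Lemma bond_id (X : nat -> uniformType) (p : forall n, X n.+1 -> X n)
  (i : nat) (le_ii : (i <= i)%N) (x : X i) : bond p le_ii x = x.
Proof.
rewrite /bond; move: (esym (subnK le_ii)); rewrite subnn => e.
by rewrite (eq_irrelevance e erefl).
Qed.

Lemma bondS (X : nat -> uniformType) (p : forall n, X n.+1 -> X n)
  (i j : nat) (le_ij : (i <= j)%N) (le_iSj : (i <= j.+1)%N) (x : X j.+1) :
  bond p le_iSj x = bond p le_ij (p j x).
Proof.
rewrite /bond; move: (esym (subnK le_ij)) (esym (subnK le_iSj)).
rewrite subSn // => e.
move: (j - i)%N e => k e; subst j => e'.
by rewrite (eq_irrelevance e' erefl).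
Qed.

(* The disjoint union uniformity: a subset of [(A + B) * (A + B)] is an
   entourage when its traces on [A * A] and on [B * B] are. *)
Section sum_uniform.
Variables A B : uniformType.
Local Open Scope relation_scope.

Definition sum_ent : set_system ((A + B) * (A + B)) :=
  [set E | entourage [set xy : A * A | E (inl xy.1, inl xy.2)] /\
           entourage [set xy : B * B | E (inr xy.1, inr xy.2)]].

Let sum_ent_filter : Filter sum_ent.
Proof.
split; first by split; exact: filterT.
- by move=> P Q [PA PB] [QA QB]; split; exact: filterI.
- move=> P Q PQ [PA PB].
  by split; [apply: filterS PA|apply: filterS PB] => xy; exact: PQ.
Qed.

Let sum_ent_refl (E : set ((A + B) * (A + B))) : sum_ent E -> diagonal `<=` E.
Proof.
move=> [EA EB] [x y] /diagonalP ->; case: y => z.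
- exact: (entourage_refl z EA).
- exact: (entourage_refl z EB).
Qed.

Let sum_ent_inv (E : set ((A + B) * (A + B))) : sum_ent E -> sum_ent E^-1.
Proof. by move=> [/entourage_inv EA /entourage_inv EB]; split. Qed.

Let sum_ent_split (E : set ((A + B) * (A + B))) :
  sum_ent E -> exists2 F, sum_ent F & F \; F `<=` E.
Proof.
move=> [/entourage_split_ex[FA entFA sFA] /entourage_split_ex[FB entFB sFB]].
exists [set xy | match xy with
                 | (inl a, inl a') => FA (a, a')
                 | (inr b, inr b') => FB (b, b')
                 | _ => False
                 end].
  by split; [apply: filterS entFA|apply: filterS entFB] => -[].
move=> [[x|x] [y|y]] [[z|z]] //= Fxz Fzy.
- by apply: (sFA (x, y)); exists z.
- by apply: (sFB (x, y)); exists z.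
Qed.

HB.instance Definition _ := isUniform.Build (A + B)%type
  sum_ent_filter sum_ent_refl sum_ent_inv sum_ent_split.

End sum_uniform.

Section convergence.
Variables (X : nat -> uniformType) (p : forall n, X n.+1 -> X n).

(* X_n + (X_(n-1) + (... + X_0)) *)
Fixpoint dunion (n : nat) : uniformType :=
  match n with
  | 0 => X 0
  | m.+1 => (X m.+1 + dunion m)%type
  end.

Definition top_summand (n : nat) : X n -> dunion n :=
  match n with
  | 0 => fun x => x
  | _.+1 => fun x => inl x
  end.

Definition dunion_bond (n : nat) (u : dunion n.+1) : dunion n :=
  match u with
  | inl x => top_summand (p x)
  | inr v => v
  end.

(* X_{N + infty} *)
Definition lim_union : uniformType := inv_lim dunion_bond.

(* The copy of the inverse limit X in X_{N + infty}. *)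
Definition lim_part : set lim_union :=
  [set u | exists x : inv_lim p, forall n, val u n = top_summand (val x n)].

(* The copy of X_i in X_{N + infty}: the i-th coordinate lies in the summand
   X_i of X_i + ... + X_0, and it determines the other ones, as it is kept by
   the inclusions into the larger unions. *)
Definition summand_part (i : nat) : set lim_union :=
  [set u | (exists x : X i, val u i = top_summand x) /\
           forall n, (i <= n)%N -> val u n.+1 = @inr (X n.+1) (dunion n) (val u n)].

Definition convergent (R : realType) : Prop :=
  forall N : set lim_union, uniform_nbhd R lim_part N ->
    \forall i \near \oo, summand_part i `<=` N.

End convergence.

Definition close_maps (R : realType) (T : Type) (M : metricType R) (a : R)
    (f g : T -> M) : Prop :=
  forall x, mdist (f x) (g x) <= a.

Definition unit_interval (R : realType) : uniformType :=
  set_type [set t : R | 0 <= t <= 1].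

Definition uniform_homotopy (R : realType) (A B : uniformType) (f g : A -> B)
    (h : A * unit_interval R -> B) : Prop :=
  [/\ unif_continuous h,
      forall x t, val t = 0 -> h (x, t) = f x
    & forall x t, val t = 1 -> h (x, t) = g x].

(* Main.v *)
Require Import Defs.
From HB Require Import structures.
From mathcomp Require Import all_boot all_order all_algebra.
From mathcomp Require Import all_classical all_reals.
From mathcomp Require Import topology.
From mathcomp Require Import lra.

Set Implicit Arguments.
Unset Strict Implicit.
Unset Printing Implicit Defensive.

Import Order.TTheory GRing.Theory Num.Theory.
Import numFieldTopology.Exports.

Local Open Scope classical_set_scope.
Local Open Scope ring_scope.

(** The ANR property enters only in the following form: a complete uniform ANR is
  a uniform neighbourhood retract of a space of real functions
  ([ANR_kuratowski_retract]), in which maps extend and nearby maps are joined by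
  segments. So maps into it extend to uniform neighbourhoods, and nearby maps
  into it are joined by small homotopies.

  Replace the metric of each [X n] by an equivalent one for which the bonding
  maps do not increase distances and for which the [n]-th coordinate of a point
  of [X] determines the point up to [2^-n] ([adapted_short_bonds]). The supremum
  of the coordinate distances is then a metric [D] on [X], and the number
  alpha_i^* is chosen so that points of [X i] at distance at most alpha_i^* in
  the given metric are at distance at most [2^-(i+1)] in the new one.

  From (a) to (b). Let [r] be a retraction onto [X] of a neighbourhood of its
  image under the Kuratowski embedding [y |-> D y]. By convergence, for [j] large,
  every point of [X j] has its image in [X m] close to the [m]-th coordinate of
  a point of [X]; so the function that measures the distance to that image in
  [X m] lies in the domain of [r], and this gives a map [r_j] from [X j] to [X]
  which moves the coordinates up to [m] only little ([near_retraction]). Take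
  for [s] the map [r_j] followed by the projection to [X k]. For a sufficiently large [l],
  the bonding map from [X l] to [X k] is so close to the [k]-th coordinate of
  [r_l] that the two are joined by a small homotopy in [X k], while [r_l] is
  close in [X] to the composite of [r_j] with the bonding map, and is joined to
  it by a small homotopy in [X] ([retract_approx_dominated]).

  From (b) to (a). Let [A] be a closed copy of [X] in a space [Z], and let
  [g] be the inverse homeomorphism from [A] to [X]. Each coordinate of [g]
  extends over a neighbourhood of [A], but the neighbourhood depends on the
  coordinate. Condition (b) transfers an extension of a coordinate to one of a
  later coordinate without making the neighbourhood smaller: away from [A] one
  composes with [s], near [A] one uses an extension of an even later coordinate,
  and the homotopy of (b) interpolates between them ([lift_extension]). Along
  this sequence of extensions the images in each fixed [X m] change by amounts
  that are summable by the choice of alpha_i^*, so the extensions converge,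
  uniformly on one neighbourhood of [A], to an extension of [g] with values in
  [X] ([inv_lim_extension]); composed with the embedding of [X] in [Z], it is the
  retraction sought. *)

(** * Uniform continuity for distance functions *)

Section distances.
Variable R : realType.

Definition is_pseudometric (T : Type) (d : T -> T -> R) : Prop :=
  [/\ forall x, d x x = 0, forall x y, d x y = d y x
    & forall x y z, d x z <= d x y + d y z].

Lemma metric_pseudometric (T : Type) (d : T -> T -> R) :
  is_metric d -> is_pseudometric d.
Proof. by case. Qed.

Lemma pseudometric_ge0 (T : Type) (d : T -> T -> R) :
  is_pseudometric d -> forall x y, 0 <= d x y.
Proof.
move=> [d0 dC dT] x y; have := dT x y x; rewrite d0 (dC y x) => h; lra.
Qed.

Definition ucon (T U : Type) (dT : T -> T -> R) (dU : U -> U -> R)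
    (A : set T) (f : T -> U) : Prop :=
  forall e : R, 0 < e -> exists2 r : R, 0 < r &
    forall x y, A x -> A y -> dT x y < r -> dU (f x) (f y) < e.

Definition rdist (s t : R) : R := `|s - t|.

Definition pdist (T U : Type) (dT : T -> T -> R) (dU : U -> U -> R)
  (x y : T * U) : R := Num.max (dT x.1 y.1) (dU x.2 y.2).

Lemma ucon_comp (T U V : Type) (dT : T -> T -> R) (dU : U -> U -> R)
    (dV : V -> V -> R) (A : set T) (B : set U) (f : T -> U) (g : U -> V) :
  ucon dT dU A f -> ucon dU dV B g -> (forall x, A x -> B (f x)) ->
  ucon dT dV A (g \o f).
Proof.
move=> fu gu AB e e0; have [r r0 gr] := gu e e0.
have [q q0 fq] := fu r r0; exists q => // x y Ax Ay xy.
by apply: gr; [exact: AB|exact: AB|exact: fq].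
Qed.

Lemma ucon_sub (T U : Type) (dT : T -> T -> R) (dU : U -> U -> R)
    (A B : set T) (f : T -> U) :
  (forall x, B x -> A x) -> ucon dT dU A f -> ucon dT dU B f.
Proof.
move=> BA fu e e0; have [r r0 h] := fu e e0; exists r => // x y Bx By.
by apply: h; exact: BA.
Qed.

Lemma ucon_eq (T U : Type) (dT : T -> T -> R) (dU : U -> U -> R)
    (A : set T) (f g : T -> U) :
  (forall x, A x -> f x = g x) -> ucon dT dU A f -> ucon dT dU A g.
Proof.
move=> fg fu e e0; have [r r0 h] := fu e e0; exists r => // x y Ax Ay xy.
by rewrite -(fg _ Ax) -(fg _ Ay); exact: h.
Qed.

Lemma ucon_lipschitz (T U : Type) (dT : T -> T -> R) (dU : U -> U -> R)
    (A : set T) (f : T -> U) (C : R) : 0 < C ->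
  (forall x y, A x -> A y -> dU (f x) (f y) <= C * dT x y) ->
  ucon dT dU A f.
Proof.
move=> C0 fC e e0; exists (e / C); first by rewrite divr_gt0.
move=> x y Ax Ay; rewrite ltr_pdivlMr// mulrC; exact/le_lt_trans/fC.
Qed.

Lemma ucon_short (T U : Type) (dT : T -> T -> R) (dU : U -> U -> R)
    (A : set T) (f : T -> U) :
  (forall x y, dU (f x) (f y) <= dT x y) -> ucon dT dU A f.
Proof.
by move=> fC; apply: (@ucon_lipschitz _ _ _ _ _ _ 1) => // x y _ _; rewrite mul1r.
Qed.

Lemma ucon_pair (T U V : Type) (dT : T -> T -> R) (dU : U -> U -> R)
    (dV : V -> V -> R) (A : set T) (f : T -> U) (g : T -> V) :
  ucon dT dU A f -> ucon dT dV A g ->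
  ucon dT (pdist dU dV) A (fun x => (f x, g x)).
Proof.
move=> fu gu e e0; have [r r0 fr] := fu e e0; have [q q0 gq] := gu e e0.
exists (Num.min r q); first by rewrite lt_min r0 q0.
move=> x y Ax Ay; rewrite lt_min => /andP[xr xq].
by rewrite /pdist/= gt_max fr// gq.
Qed.

Lemma ucon_fst (T U : Type) (dT : T -> T -> R) (dU : U -> U -> R)
  (A : set (T * U)) : ucon (pdist dT dU) dT A fst.
Proof. by apply: ucon_short => x y; rewrite /pdist le_max lexx. Qed.

Lemma ucon_snd (T U : Type) (dT : T -> T -> R) (dU : U -> U -> R)
  (A : set (T * U)) : ucon (pdist dT dU) dU A snd.
Proof. by apply: ucon_short => x y; rewrite /pdist le_max lexx orbT. Qed.

(** The overlap is what makes this work without any intermediate points: two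
  points closer than [b - a] cannot lie on different sides of it. *)
Lemma ucon_glue (T U : Type) (dT : T -> T -> R) (dU : U -> U -> R)
    (A : set T) (w : T -> R) (a b : R) (f : T -> U) :
  a < b -> (forall x y, `|w x - w y| <= dT x y) ->
  ucon dT dU [set x | A x /\ w x <= b] f ->
  ucon dT dU [set x | A x /\ a <= w x] f ->
  ucon dT dU A f.
Proof.
move=> ab wL lo hi e e0; have [r r0 hr] := lo e e0; have [q q0 hq] := hi e e0.
exists (Num.min (b - a) (Num.min r q)).
  by rewrite !lt_min r0 q0 subr_gt0 ab.
move=> x y Ax Ay; rewrite !lt_min => /and3P[xyab xyr xyq].
have := le_lt_trans (wL x y) xyab; rewrite ltr_norml => /andP[h1 h2].
case: (lerP (w x) b) => xb; case: (lerP (w y) b) => yb.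
- by apply: hr.
- by apply: hq => //; split=> //; lra.
- by apply: hq => //; split=> //; lra.
- by apply: hq => //; split=> //; lra.
Qed.

Definition clamp (t : R) : R :=
  if t <= 0 then 0 else if 1 <= t then 1 else t.

Lemma clamp_itv t : 0 <= clamp t <= 1.
Proof.
by rewrite /clamp; case: (lerP t 0) => h; [|case: (lerP 1 t) => k];
  apply/andP; split; lra.
Qed.

Lemma clamp_le0 t : t <= 0 -> clamp t = 0.
Proof. by rewrite /clamp => ->. Qed.

Lemma clamp_ge1 t : 1 <= t -> clamp t = 1.
Proof. by rewrite /clamp => t1; case: (lerP t 0) => h; [lra|rewrite t1]. Qed.

Lemma clamp_short s t : `|clamp s - clamp t| <= `|s - t|.
Proof.
have := ler_norm (s - t); have := ler_norm (t - s); rewrite (distrC t s).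
rewrite /clamp; case: (lerP s 0) => h; [|case: (lerP 1 s) => k];
  (case: (lerP t 0) => h'; [|case: (lerP 1 t) => k']);
  by move=> *; rewrite ler_norml; apply/andP; split; lra.
Qed.

(** * Powers of one half *)

Definition half_pow (n : nat) : R := 2^-1 ^+ n.

Lemma half_pow_gt0 n : 0 < half_pow n.
Proof. by rewrite exprn_gt0// invr_gt0. Qed.

Lemma half_powS n : half_pow n.+1 = half_pow n / 2.
Proof. by rewrite /half_pow exprS mulrC. Qed.

Lemma half_pow_le m n : (m <= n)%N -> half_pow n <= half_pow m.
Proof.
by move=> mn; apply: ler_wiXn2l; rewrite ?invr_ge0 ?invf_le1 ?ler1n.
Qed.

Lemma half_pow_le1 n : half_pow n <= 1.
Proof. by have := half_pow_le (leq0n n); rewrite /half_pow expr0. Qed.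

Lemma half_pow_small (e : R) : 0 < e -> exists n, half_pow n < e.
Proof.
move=> e0; have [n hn] : exists n : nat, e^-1 < n%:R.
  by exists (Num.truncn e^-1).+1; rewrite truncnS_gt.
exists n; rewrite /half_pow exprVn invf_plt ?posrE ?exprn_gt0//.
by apply: (lt_le_trans hn); rewrite -natrX ler_nat ltnW// ltn_expl.
Qed.

Lemma half_pow_bound (x y C : R) : 0 < C ->
  (forall n, x <= y + C * half_pow n) -> x <= y.
Proof.
move=> C0 h; apply/ler_addgt0Pr => e e0.
have [n hn] := half_pow_small (divr_gt0 e0 C0).
apply: (le_trans (h n)); rewrite lerD2l.
by rewrite mulrC -ler_pdivlMr// ltW.
Qed.

End distances.

(** * Infimal convolution with a pseudometric *)

Section inf_convolution.
Variables (R : realType) (T : Type) (A : set T) (rho : T -> T -> R).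
Hypothesis rhoP : is_pseudometric rho.
Hypothesis A0 : A !=set0.

Definition inf_conv (c : T -> R) (z : T) : R :=
  inf [set c a + rho z a | a in A].

Variable c : T -> R.
Hypothesis c0 : forall a, A a -> 0 <= c a.

Lemma inf_conv_le z a : A a -> inf_conv c z <= c a + rho z a.
Proof.
move=> Aa; apply: ge_inf; last by exists a.
exists 0 => _ [b Ab <-]; apply: addr_ge0; first exact: c0.
exact: pseudometric_ge0.
Qed.

Lemma le_inf_conv z x :
  (forall a, A a -> x <= c a + rho z a) -> x <= inf_conv c z.
Proof.
move=> h; apply: lb_le_inf; first by case: A0 => a Aa; exists (c a + rho z a), a.
by move=> _ [a Aa <-]; exact: h.
Qed.

Lemma inf_conv_lt z x :
  inf_conv c z < x -> exists2 a, A a & c a + rho z a < x.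
Proof.
move=> zx; apply: contrapT => no; move: zx; apply/negP; rewrite -leNgt.
apply: le_inf_conv => a Aa; rewrite leNgt; apply/negP => h.
by apply: no; exists a.
Qed.

Lemma inf_conv_short z z' : `|inf_conv c z - inf_conv c z'| <= rho z z'.
Proof.
have [_ rC rT] := rhoP.
suff h u v : inf_conv c u - inf_conv c v <= rho u v.
  have h1 := h z z'; have := h z' z; rewrite rC ler_norml => h2.
  by apply/andP; split; lra.
rewrite lerBlDr addrC -lerBlDr; apply: le_inf_conv => a Aa.
by have := inf_conv_le u Aa; have := rT u v a => h1 h2; lra.
Qed.

Lemma inf_conv_eq a : A a ->
  (forall b, A b -> c a <= c b + rho a b) -> inf_conv c a = c a.
Proof.
have [r0 _ _] := rhoP => Aa h; apply/eqP; rewrite eq_le; apply/andP; split.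
  by have := inf_conv_le a Aa; rewrite r0 addr0.
exact: le_inf_conv.
Qed.

End inf_convolution.

Definition set_dist (R : realType) (T : Type) (d : T -> T -> R) (A : set T) :=
  inf_conv A d (fun=> 0).

Section set_distance.
Variables (R : realType) (T : Type) (d : T -> T -> R) (A : set T).
Hypothesis dP : is_pseudometric d.
Hypothesis A0 : A !=set0.

Lemma set_dist_short x y : `|set_dist d A x - set_dist d A y| <= d x y.
Proof. exact: inf_conv_short. Qed.

Lemma set_dist_lt x e : set_dist d A x < e -> exists2 a, A a & d x a < e.
Proof. by move=> /(inf_conv_lt A0)[a Aa]; rewrite add0r; exists a. Qed.

Lemma set_dist_le x a : A a -> set_dist d A x <= d x a.
Proof.
move=> Aa; rewrite -[leRHS]add0r.
exact: (@inf_conv_le _ _ A d dP (fun=> 0)).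
Qed.

Lemma set_dist_ge0 x : 0 <= set_dist d A x.
Proof.
by apply: le_inf_conv => // a Aa; rewrite add0r pseudometric_ge0.
Qed.

Lemma set_dist0 a : A a -> set_dist d A a = 0.
Proof.
move=> Aa; apply/eqP; rewrite eq_le set_dist_ge0 andbT.
by have [d0 _ _] := dP; rewrite -[leRHS](d0 a) set_dist_le.
Qed.

End set_distance.

(** * Uniform neighbourhood retracts of function spaces *)

Definition near_kuratowski (R : realType) (Y : Type) (d : Y -> Y -> R) (e : R)
    (phi : Y -> R) : Prop :=
  exists y, forall s, `|phi s - d y s| <= e.

(** The Kuratowski embedding [y |-> d y] identifies [Y] with a set of functions
  [Y -> R], here with the uniform distance; the property says that this set is
  a uniform neighbourhood retract. It is how the ANR property gets used: real
  functions extend, and can be joined by segments. *)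
Definition kuratowski_retract (R : realType) (Y : Type) (d : Y -> Y -> R) :
    Prop :=
  exists e0 : R, exists r : (Y -> R) -> Y,
    [/\ 0 < e0, forall y, r (d y) = y
      & forall e, 0 < e -> exists2 q : R, 0 < q &
          forall phi psi, near_kuratowski d e0 phi -> near_kuratowski d e0 psi ->
            (forall s, `|phi s - psi s| <= q) -> d (r phi) (r psi) < e].

Section retract_consequences.
Variable R : realType.

(** [omega t = inf_n (2^-n + t / delta_n)] is the usual subadditive modulus;
  [rho] is [omega] of the distance. *)
Lemma modulus_pseudometric (T U : Type) (dT : T -> T -> R) (dU : U -> U -> R)
    (A : set T) (f : T -> U) :
  is_pseudometric dT -> (forall x y, dU x y <= 1) -> ucon dT dU A f ->
  exists rho : T -> T -> R,
    [/\ is_pseudometric rho,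
        forall e, 0 < e -> exists2 q : R, 0 < q &
          forall x y, dT x y < q -> rho x y < e
      & forall x y, A x -> A y -> dU (f x) (f y) <= rho x y].
Proof.
move=> dP dU1 fu; have [d0 dC dTr] := dP.
have dge := pseudometric_ge0 dP.
have /choice[del delP] n : exists q : R, 0 < q /\
    forall x y, A x -> A y -> dT x y < q -> dU (f x) (f y) < half_pow R n.
  by have [q q0 h] := fu _ (half_pow_gt0 R n); exists q.
have del0 n : 0 < del n by case: (delP n).
pose W t := [set half_pow R n + t / del n | n in [set: nat]].
pose om t := inf (W t).
have W0 t : W t !=set0 by exists (half_pow R 0%N + t / del 0%N), 0%N.
have Wlb t : 0 <= t -> has_lbound (W t).
  move=> t0; exists 0 => _ [n _ <-].
  by rewrite addr_ge0 ?divr_ge0 ?(ltW (half_pow_gt0 _ _)) ?(ltW (del0 _)).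
have om_le t n : 0 <= t -> om t <= half_pow R n + t / del n.
  by move=> t0; apply: ge_inf; [exact: Wlb|exists n].
have le_om t x : (forall n, x <= half_pow R n + t / del n) -> x <= om t.
  by move=> h; apply: lb_le_inf => // _ [n _ <-].
have om_mono s t : 0 <= s -> s <= t -> om s <= om t.
  move=> s0 st; apply: le_om => n; apply: (le_trans (om_le s n s0)).
  by rewrite lerD2l ler_pM2r ?invr_gt0.
have om_add s t : 0 <= s -> 0 <= t -> om (s + t) <= om s + om t.
  move=> s0 t0.
  have key n m : om (s + t) <=
      (half_pow R n + s / del n) + (half_pow R m + t / del m).
    have hn := half_pow_gt0 R n; have hm := half_pow_gt0 R m.
    have [nm|/ltW mn] := leP (del n) (del m).
      have := om_le (s + t) m (addr_ge0 s0 t0); rewrite mulrDl.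
      have : s / del m <= s / del n by rewrite ler_wpM2l// lef_pV2 ?posrE.
      by move=> h1 h2; lra.
    have := om_le (s + t) n (addr_ge0 s0 t0); rewrite mulrDl.
    have : t / del n <= t / del m by rewrite ler_wpM2l// lef_pV2 ?posrE.
    by move=> h1 h2; lra.
  rewrite -lerBlDr; apply: (le_om) => n; rewrite lerBlDr -lerBlDl.
  by apply: le_om => m; rewrite lerBlDl.
have om0 : om 0 = 0.
  apply/eqP; rewrite eq_le; apply/andP; split.
    apply: (@half_pow_bound _ _ _ 1) => // n.
    by have := om_le 0 n (lexx _); rewrite mul0r addr0 add0r mul1r.
  by apply: le_om => n; rewrite mul0r addr0 (ltW (half_pow_gt0 _ _)).
exists (fun x y => om (dT x y)); split.
- split=> [x|x y|x y z]; [by rewrite d0|by rewrite dC|].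
  apply: (le_trans (om_mono _ _ (dge _ _) (dTr x y z))).
  exact: om_add.
- move=> e e0; have [n hn] := half_pow_small (divr_gt0 e0 (@ltr0Sn R 1)).
  exists (e / 2 * del n); first by rewrite mulr_gt0// divr_gt0.
  move=> x y; rewrite -ltr_pdivrMr// => h.
  by have := om_le _ n (dge x y) => h2; lra.
- move=> x y Ax Ay; apply: le_om => n.
  have [xy|xy] := ltP (dT x y) (del n).
    have [_ /(_ x y Ax Ay xy) h] := delP n.
    have : 0 <= dT x y / del n by rewrite divr_ge0// ltW.
    by move=> h'; lra.
  have : 1 <= dT x y / del n by rewrite ler_pdivlMr// mul1r.
  by have := dU1 (f x) (f y); have := half_pow_gt0 R n => h1 h2 h3; lra.
Qed.

(** McShane's formula extends all the real functions [d (f _) s] at once and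
  with a common modulus; the retraction brings the result back to [Y]. *)
Lemma kuratowski_retract_extension (Z Y : Type) (dZ : Z -> Z -> R)
    (d : Y -> Y -> R) (A : set Z) (f : Z -> Y) :
  is_pseudometric dZ -> is_pseudometric d -> (forall x y, d x y <= 1) ->
  kuratowski_retract d -> A !=set0 -> ucon dZ d A f ->
  exists (F : Z -> Y) (c : R),
    [/\ 0 < c, forall a, A a -> F a = f a
      & ucon dZ d [set z | set_dist dZ A z < c] F].
Proof.
move=> dZP dP d1 [e0 [r [e00 rK ru]]] A0 fu.
have [rho [rhoP rho_small frho]] := modulus_pseudometric dZP d1 fu.
have [_ dC dT] := dP; have [_ rC _] := rhoP.
pose Phi z s := inf_conv A rho (fun a => d (f a) s) z.
have PhiA a : A a -> Phi a = d (f a).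
  move=> Aa; apply/funext => s; apply: inf_conv_eq => //.
    by move=> *; exact: pseudometric_ge0.
  move=> b Ab; have := dT (f a) (f b) s; have := frho _ _ Aa Ab.
  by move=> h1 h2; lra.
have Phi_short z z' s : `|Phi z s - Phi z' s| <= rho z z'.
  by apply: inf_conv_short => // a Aa; exact: pseudometric_ge0.
have [c c0 hc] := rho_small e0 e00.
have near z : set_dist dZ A z < c -> near_kuratowski d e0 (Phi z).
  move=> /(set_dist_lt A0)[a Aa za]; exists (f a) => s.
  by rewrite -(PhiA a Aa); apply: (le_trans (Phi_short _ _ _)); apply/ltW/hc.
exists (fun z => r (Phi z)), c; split=> // [a Aa|]; first by rewrite PhiA.
move=> e /ru[q q0 hq]; have [q' q'0 hq'] := rho_small q q0.
exists q' => // x y Ax Ay xy; apply: hq; [exact: near|exact: near|].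
by move=> s; apply: (le_trans (Phi_short _ _ _)); apply/ltW/hq'.
Qed.

(** Two nearby points are joined by a path depending uniformly continuously on
  the pair, and constant on the diagonal. *)
Definition equiconnecting (Y : Type) (d : Y -> Y -> R) (eta : R)
    (gam : Y -> Y -> R -> Y) : Prop :=
  [/\ 0 < eta, forall x y, gam x y 0 = x, forall x y, gam x y 1 = y,
      forall x t, gam x x t = x
    & ucon (pdist (pdist d d) (@rdist R)) d
        [set u : Y * Y * R | d u.1.1 u.1.2 < eta /\ 0 <= u.2 <= 1]
        (fun u => gam u.1.1 u.1.2 u.2)].

(** The path is the image under the retraction of the segment joining the two
  points in the function space. *)
Lemma kuratowski_retract_equiconnected (Y : Type) (d : Y -> Y -> R) :
  is_pseudometric d -> kuratowski_retract d ->
  exists eta gam, equiconnecting d eta gam.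
Proof.
move=> dP [e0 [r [e00 rK ru]]]; have [d0 dC dT] := dP.
have dge := pseudometric_ge0 dP.
have d_short x y s : `|d x s - d y s| <= d x y.
  have := dT x y s; have := dT y x s; rewrite (dC y x) ler_norml => h1 h2.
  by apply/andP; split; lra.
pose Phi x y t s := (1 - t) * d x s + t * d y s.
pose eta := Num.min 1 e0.
exists eta, (fun x y t => r (Phi x y t)); split.
- by rewrite lt_min ltr01.
- move=> x y; rewrite -[RHS]rK; congr r; apply/funext => s.
  by rewrite /Phi subr0 mul1r mul0r addr0.
- move=> x y; rewrite -[RHS]rK; congr r; apply/funext => s.
  by rewrite /Phi subrr mul1r mul0r add0r.
- move=> x t; rewrite -[RHS]rK; congr r; apply/funext => s.
  by rewrite /Phi -mulrDl subrK mul1r.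
- move=> e /ru[q q0 hq]; exists (q / 2); first by rewrite divr_gt0.
  have near x y t : d x y < eta -> 0 <= t <= 1 ->
      near_kuratowski d e0 (Phi x y t).
    rewrite lt_min => /andP[_ xy] /andP[t0 t1]; exists x => s; rewrite /Phi.
    have -> : (1 - t) * d x s + t * d y s - d x s = t * (d y s - d x s) by lra.
    rewrite normrM (ger0_norm t0); apply: le_trans (ltW xy).
    rewrite (dC x y); apply: le_trans (d_short y x s).
    by apply: ler_piMl.
  move=> [[x y] t] [[x' y'] t'] /= [xy t01] [xy' t01'].
  rewrite /pdist/= !gt_max -andbA => /and3P[xx' yy' tt'].
  apply: hq; [exact: near|exact: near|] => s; rewrite /Phi.
  have -> : (1 - t) * d x s + t * d y s - ((1 - t') * d x' s + t' * d y' s) =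
     (1 - t) * (d x s - d x' s) + t * (d y s - d y' s) +
     (t' - t) * (d x' s - d y' s) by lra.
  have /andP[t0 t1] := t01.
  have b1 : `|(1 - t) * (d x s - d x' s)| <= (1 - t) * (q / 2).
    rewrite normrM ger0_norm ?subr_ge0//; apply: ler_wpM2l; first by rewrite subr_ge0.
    by apply: (le_trans (d_short _ _ _)); exact: ltW.
  have b2 : `|t * (d y s - d y' s)| <= t * (q / 2).
    rewrite normrM ger0_norm//; apply: ler_wpM2l => //.
    by apply: (le_trans (d_short _ _ _)); exact: ltW.
  have b3 : `|(t' - t) * (d x' s - d y' s)| <= q / 2.
    rewrite normrM distrC -[leRHS]mulr1; apply: ler_pM => //; first exact: ltW tt'.
    apply: (le_trans (d_short _ _ _)); apply/ltW; apply: (lt_le_trans xy').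
    by rewrite /eta ge_min lexx.
  apply: (le_trans (ler_normD _ _)).
  have := ler_normD ((1 - t) * (d x s - d x' s)) (t * (d y s - d y' s)).
  by move=> h; lra.
Qed.

Lemma equiconnecting_close (Y : Type) (d : Y -> Y -> R) (eta : R) gam :
  is_pseudometric d -> equiconnecting d eta gam ->
  forall e, 0 < e -> exists q : R, [/\ 0 < q, q <= eta
    & forall x y t, 0 <= t <= 1 -> d x y < q -> d (gam x y t) x < e].
Proof.
move=> [d0 dC dT] [eta0 _ _ gxx gu] e e0; have [q q0 hq] := gu e e0.
exists (Num.min q eta); split; first by rewrite lt_min q0.
  by rewrite ge_min lexx orbT.
move=> x y t t01; rewrite lt_min => /andP[xyq xye].
rewrite -{2}(gxx x t); apply: (hq ((x, y), t) ((x, x), t)) => //=.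
  by rewrite d0.
by rewrite /pdist/= !gt_max d0 q0 dC xyq /rdist subrr normr0.
Qed.

(** A map can be deformed near [A] along a homotopy given only near [A]: the
  time parameter is a cutoff of the distance to [A]. *)
Lemma glue_homotopy (Z V : Type) (dZ : Z -> Z -> R) (dV : V -> V -> R)
    (w : Z -> R) (N : set Z) (P : Z -> V) (c : R) (K : Z -> R -> V) :
  (forall x y, `|w x - w y| <= dZ x y) -> ucon dZ dV N P -> 0 < c ->
  ucon (pdist dZ (@rdist R)) dV
    [set u : Z * R | [/\ N u.1, w u.1 < c & 0 <= u.2 <= 1]]
    (fun u => K u.1 u.2) ->
  (forall z, N z -> w z < c -> K z 0 = P z) ->
  exists P' : Z -> V,
    [/\ ucon dZ dV N P', forall z, w z <= c / 3 -> P' z = K z 1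
      & forall z, P' z = P z \/
          (w z < c /\ exists2 t, 0 <= t <= 1 & P' z = K z t)].
Proof.
move=> wL Pu c0 Ku K0; pose tau x : R := clamp (2 - 3 * x / c).
exists (fun z => if w z < c then K z (tau (w z)) else P z); split.
- apply: (@ucon_glue _ _ _ _ _ _ w (2 * c / 3) (5 * c / 6)) => //; first by lra.
    apply: (ucon_eq (f := (fun u => K u.1 u.2) \o (fun z => (z, tau (w z))))).
      by move=> z [/= _ wz]; rewrite ifT//; lra.
    apply: ucon_comp Ku _; last first.
      by move=> z /= [Nz wz]; split; [exact: Nz|lra|exact: clamp_itv].
    apply: ucon_pair; first by apply: ucon_short => x y.
    apply: (@ucon_lipschitz _ _ _ _ _ _ _ (3 / c)); first by rewrite divr_gt0.
    move=> x y _ _; rewrite /rdist /tau; apply: (le_trans (clamp_short _ _)).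
    have -> : 2 - 3 * w x / c - (2 - 3 * w y / c) = 3 / c * (w y - w x) by lra.
    have h : 0 <= 3 / c by rewrite divr_ge0// ltW.
    by rewrite normrM (ger0_norm h) distrC; apply: ler_wpM2l.
  apply: (ucon_eq (f := P)); last by apply: ucon_sub Pu => z [].
  move=> z [Nz wz]; case: ltP => // wc; rewrite /tau clamp_le0 ?K0//.
  by rewrite subr_le0 ler_pdivlMr//; lra.
- move=> z wz; rewrite ifT; last by lra.
  by rewrite /tau clamp_ge1// lerBrDl -lerBrDr ler_pdivrMr//; lra.
- move=> z; case: ltP => wc; [right|by left]; split=> //.
  by exists (tau (w z)) => //; exact: clamp_itv.
Qed.

End retract_consequences.

(** * Compatible metrics *)

Section compatible_metrics.
Variable R : realType.

Lemma compatible_entourageP (T : uniformType) (d : T -> T -> R)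
    (E : set (T * T)) : compatible_metric d ->
  entourage E <-> exists2 e : R, 0 < e & forall x y, d x y < e -> E (x, y).
Proof.
move=> [_ ->]; split=> [[e e0 h]|[e e0 h]]; exists e => //.
  by move=> x y xy; exact: (h (x, y)).
by move=> [x y]; exact: h.
Qed.

Lemma compatible_metric_intro (T : uniformType) (d : T -> T -> R) :
  is_metric d ->
  (forall e, 0 < e -> entourage [set xy : T * T | d xy.1 xy.2 < e]) ->
  (forall E, entourage E ->
     exists2 e : R, 0 < e & forall x y, d x y < e -> E (x, y)) ->
  compatible_metric d.
Proof.
move=> dm h1 h2; split=> //; apply/seteqP; split=> E.
  by move=> /h2[e e0 he]; exists e => // -[x y]; exact: he.
by move=> [e e0 he]; apply: filterS (h1 e e0) => -[x y] xy; exact: (he (x, y)).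
Qed.

Lemma unif_continuous_uconP (T U : uniformType) (dT : T -> T -> R) (dU : U -> U -> R)
    (f : T -> U) : compatible_metric dT -> compatible_metric dU ->
  unif_continuous f <-> ucon dT dU setT f.
Proof.
move=> cT cU; split=> [fu e e0|fu E].
  have /(compatible_entourageP _ cU)/fu : exists2 q : R, 0 < q &
      forall x y, dU x y < q -> [set xy : U * U | dU xy.1 xy.2 < e] (x, y).
    by exists e.
  by move=> /(compatible_entourageP _ cT)[r r0 h]; exists r => // x y _ _; exact: h.
move=> /(compatible_entourageP _ cU)[e e0 he]; have [r r0 h] := fu e e0.
apply/(compatible_entourageP _ cT); exists r => // x y xy.
by apply: he; exact: h.
Qed.

Lemma mdist_compatible (M : metricType R) : compatible_metric (@mdist R M).
Proof.
split; first split.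
- exact: mdistxx.
- exact: mdist_positivity.
- exact: metric_sym.
- by move=> x y z; exact: metric_triangle.
- rewrite entourageE_subproof; congr entourage_.
  by apply/funext => x; apply/funext => e; rewrite ballEmdist.
Qed.

Lemma trunc_metric (T : Type) (d : T -> T -> R) (c : R) :
  0 < c -> is_metric d -> is_metric (fun x y => Num.min c (d x y)).
Proof.
move=> c0 dm; have dge := pseudometric_ge0 (metric_pseudometric dm).
case: dm => d0 d1 dC dT; split=> [x|x y|x y|x y z].
- by rewrite d0; apply/min_idPr/ltW.
- case: (lerP c (d x y)) => h h'; last exact: d1.
  by move: c0; rewrite h' ltxx.
- by rewrite dC.
- have := dT x y z; have := dge x y; have := dge y z.
  by case: (lerP c (d x z)); case: (lerP c (d x y)); case: (lerP c (d y z));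
    move=> *; lra.
Qed.

Lemma trunc_compatible (T : uniformType) (d : T -> T -> R) (c : R) :
  0 < c -> compatible_metric d ->
  compatible_metric (fun x y => Num.min c (d x y)).
Proof.
move=> c0 cd; apply: compatible_metric_intro.
- by apply: trunc_metric => //; case: cd.
- move=> e e0; apply/(compatible_entourageP _ cd); exists e => // x y xy /=.
  by rewrite gt_min xy orbT.
- move=> E /(compatible_entourageP _ cd)[e e0 h]; exists (Num.min e c).
    by rewrite lt_min e0.
  move=> x y; rewrite lt_min !gt_min ltxx/= => /andP[/orP[h1|h1] h2].
    by apply: h; exact: lt_trans h1.
  exact: h.
Qed.

Lemma subset_compatible (T : uniformType) (d : T -> T -> R) (A : set T) :
  compatible_metric d ->
  compatible_metric (T := set_type A) (fun x y => d (val x) (val y)).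
Proof.
move=> cd; have [[d0 d1 dC dT] _] := cd; apply: compatible_metric_intro.
- by split=> [x|x y /d1/val_inj|x y|x y z].
- move=> e e0; exists [set xy | d xy.1 xy.2 < e] => //.
  by apply/(compatible_entourageP _ cd); exists e.
- move=> E [F /(compatible_entourageP _ cd)[e e0 h] FE]; exists e => // x y xy.
  by apply: FE; exact: h.
Qed.

Lemma pdist_compatible (T U : uniformType) (dT : T -> T -> R) (dU : U -> U -> R) :
  compatible_metric dT -> compatible_metric dU ->
  compatible_metric (pdist dT dU).
Proof.
move=> cT cU; have [[d0 d1 dC dTr] _] := cT; have [[e0 e1 eC eTr] _] := cU.
have dge := pseudometric_ge0 (metric_pseudometric cT.1).
have ege := pseudometric_ge0 (metric_pseudometric cU.1).
apply: compatible_metric_intro.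
- split=> [x|[x x'] [y y']|x y|x y z]; rewrite /pdist/=.
  + by rewrite d0 e0 maxxx.
  + have := dge x y; have := ege x' y'.
    move=> h1 h2 h3; have hT : dT x y <= 0 by rewrite -h3 le_max lexx.
    have hU : dU x' y' <= 0 by rewrite -h3 le_max lexx orbT.
    by congr pair; [apply: d1|apply: e1]; lra.
  + by rewrite dC eC.
  + rewrite ge_max; apply/andP; split.
      by apply: (le_trans (dTr _ y.1 _)); apply: lerD; rewrite le_max lexx.
    by apply: (le_trans (eTr _ y.2 _)); apply: lerD; rewrite le_max lexx orbT.
- move=> e e_gt0.
  have hT : entourage [set xy : T * T | dT xy.1 xy.2 < e].
    by apply/(compatible_entourageP _ cT); exists e.
  have hU : entourage [set xy : U * U | dU xy.1 xy.2 < e].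
    by apply/(compatible_entourageP _ cU); exists e.
  apply: filterS (prod_entP hT hU) => -[x y] /= [h1 h2].
  by rewrite /pdist gt_max h1.
- move=> E [[A B] [/= /(compatible_entourageP _ cT)[e e_gt0 hA]]].
  move=> /(compatible_entourageP _ cU)[q q_gt0 hB] AB; exists (Num.min e q).
    by rewrite lt_min e_gt0.
  move=> [x x'] [y y']; rewrite /pdist/= gt_max !lt_min.
  move=> /andP[/andP[h1 _] /andP[_ h2]].
  have /AB[[[a a'] [b b']]] : (A `*` B) ((x, y), (x', y')).
    by split; [exact: hA|exact: hB].
  by move=> /= ? [<- <- <- <-].
Qed.

Lemma rdist_compatible : compatible_metric (@rdist R).
Proof.
apply: compatible_metric_intro.
- split=> [x|x y /eqP|x y|x y z]; rewrite /rdist.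
  + by rewrite subrr normr0.
  + by rewrite normr_eq0 subr_eq0 => /eqP.
  + by rewrite distrC.
  + exact: ler_distD.
- by move=> e e0; rewrite -entourage_ballE; exists e.
- move=> E; rewrite -entourage_ballE => -[e e0 h]; exists e => // x y xy.
  exact: (h (x, y)).
Qed.

Definition sum_dist (T U : Type) (dT : T -> T -> R) (dU : U -> U -> R)
    (x y : T + U) : R :=
  match x, y with
  | inl a, inl b => Num.min 1 (dT a b)
  | inr a, inr b => Num.min 1 (dU a b)
  | _, _ => 1
  end.

Lemma sum_metrizable (T U : uniformType) :
  metrizable R T -> metrizable R U -> metrizable R (T + U)%type.
Proof.
move=> [dT /(trunc_compatible ltr01)cT] [dU /(trunc_compatible ltr01)cU].
exists (sum_dist dT dU); have [dTm _] := cT; have [dUm _] := cU.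
have geT := pseudometric_ge0 (metric_pseudometric dTm).
have geU := pseudometric_ge0 (metric_pseudometric dUm).
have leT x y : Num.min 1 (dT x y) <= 1 by rewrite ge_min lexx.
have leU x y : Num.min 1 (dU x y) <= 1 by rewrite ge_min lexx.
apply: compatible_metric_intro.
- have [d0 d1 dC dTr] := dTm; have [e0 e1 eC eTr] := dUm.
  split=> [[]//|[x|x] [y|y]|[x|x] [y|y]|[x|x] [y|y] [z|z]] //=.
  + by move=> /d1 ->.
  + by move=> /eqP; rewrite oner_eq0.
  + by move=> /eqP; rewrite oner_eq0.
  + by move=> /e1 ->.
  + by have := geT x y => h; lra.
  + by have := leT x z => h; lra.
  + by have := geU y z => h; lra.
  + by have := geT y z => h; lra.
  + by have := leU x z => h; lra.
  + by have := geU x y => h; lra.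
- move=> e e0; split; [apply/(compatible_entourageP _ cT)|
    apply/(compatible_entourageP _ cU)]; by exists e.
- move=> E [/(compatible_entourageP _ cT)[e e0 hT]].
  move=> /(compatible_entourageP _ cU)[q q0 hU].
  exists (Num.min 1 (Num.min e q)); first by rewrite !lt_min ltr01 e0.
  move=> [x|x] [y|y]; rewrite lt_min => /andP[]; rewrite /= ?ltxx// lt_min.
    by move=> _ /andP[h _]; exact: hT.
  by move=> _ /andP[_ h]; exact: hU.
Qed.

Lemma dunion_metrizable (X : nat -> uniformType) n :
  (forall n, metrizable R (X n)) -> metrizable R (dunion X n).
Proof. by move=> Xm; elim: n => [|n IH]//=; exact: sum_metrizable. Qed.

(** The uniformity of the product is the coarsest one for which the projections
  are uniformly continuous; this is its elementary form, given by this lemma and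
  the next two. *)
Lemma sup_ent_component (T : choiceType) (I : Type) (Tc : I -> Uniform T) i
    (E : set (T * T)) :
  @entourage (Uniform.Pack (Tc i)) E -> sup_ent Tc E.
Proof.
move=> entE; exists E => //.
have h : `[< @entourage (Uniform.Pack (Tc i)) E >] by apply/asboolP.
pose ie : {p : {classic I} * set (T * T) |
  `[< @entourage (Uniform.Pack (Tc p.1)) p.2 >]} := exist _ (i, E) h.
by apply: (@finI_from1 _ _ _ _ ie).
Qed.

Lemma prod_entourage_proj (X : nat -> uniformType) n (E : set (X n * X n)) :
  entourage E ->
  entourage [set uv : prod_topology X * prod_topology X | E (uv.1 n, uv.2 n)].
Proof. by move=> entE; apply: (@sup_ent_component _ _ _ n); exists E. Qed.

Lemma prod_entourage_min (X : nat -> uniformType)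
    (G : set_system (prod_topology X * prod_topology X)) : Filter G ->
  (forall n (E : set (X n * X n)), entourage E ->
    G [set uv | E (uv.1 n, uv.2 n)]) ->
  forall E, entourage E -> G E.
Proof.
move=> FG GX E [_ [F _ <-] FE]; apply: filterS FE _; apply: filter_bigI => p _.
case: p => -[n B] /= /asboolP [C entC CB].
by apply: filterS (GX _ _ entC) => uv; exact: CB.
Qed.

End compatible_metrics.

(** * Completeness *)

Section fast_completeness.
Variable R : realType.

(** Rapidly converging sequences suffice to express completeness, and keep
  track of the distance to the limit. *)
Definition fast_complete (T : Type) (d : T -> T -> R) : Prop :=
  forall u : nat -> T, (forall n, d (u n) (u n.+1) <= half_pow R n) ->
    exists x, forall n, d (u n) x <= 2 * half_pow R n.

Lemma fast_cauchy_tail (T : Type) (d : T -> T -> R) (u : nat -> T) :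
  is_pseudometric d -> (forall n, d (u n) (u n.+1) <= half_pow R n) ->
  forall m n, (m <= n)%N -> d (u m) (u n) <= 2 * half_pow R m.
Proof.
move=> [d0 _ dT] h m n /subnK <-; move: (n - m)%N => k {n}.
suff : d (u m) (u (k + m)%N) <= 2 * half_pow R m - 2 * half_pow R (k + m).
  by have := half_pow_gt0 R (k + m) => ? ?; lra.
elim: k => [|k IH]; first by rewrite add0n d0 subrr.
have := dT (u m) (u (k + m)%N) (u (k.+1 + m)%N); have := h (k + m)%N.
by rewrite addSn half_powS => h1 h2; lra.
Qed.

Lemma complete_uniform_fast (T : uniformType) (d : T -> T -> R) :
  compatible_metric d -> complete_uniform T -> fast_complete d.
Proof.
move=> cd Tc u hu; have [[d0 _ dC dT] _] := cd.
have dP := metric_pseudometric cd.1.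
have tail := fast_cauchy_tail dP hu.
have [|x ux] := Tc (u @ \oo) _.
  move=> E /(compatible_entourageP _ cd)[e e0 he].
  have [n hn] := half_pow_small (divr_gt0 e0 (@ltr0Sn R 3)).
  exists (u @` [set m | (n <= m)%N], u @` [set m | (n <= m)%N]).
    by split; exists n => // m /= nm; exists m.
  move=> [_ _] /= [[a na <-] [b nb <-]]; apply: he.
  by have := dT (u a) (u n) (u b); rewrite (dC (u a) (u n)); have := tail _ _ na;
    have := tail _ _ nb => h1 h2 h3; lra.
exists x => n; apply/ler_addgt0Pr => e e0.
have /(cvg_entourage ux) : entourage [set xy : T * T | d xy.1 xy.2 < e].
  by apply/(compatible_entourageP _ cd); exists e.
move=> [m _ hm]; have := hm (maxn m n) (leq_maxl _ _) => /=.
have := tail _ _ (leq_maxr m n); have := dT (u n) (u (maxn m n)) x.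
by rewrite (dC x) => h1 h2 h3; lra.
Qed.

End fast_completeness.

(** * Metrics on inverse limits *)

Section inverse_limit_metric.
Variables (R : realType) (X : nat -> uniformType).
Variable p : forall n, X n.+1 -> X n.
Variable d : forall n, X n -> X n -> R.

Definition lim_dist (x y : inv_lim p) : R :=
  sup [set d (val x n) (val y n) | n in [set: nat]].

Hypothesis cd : forall n, compatible_metric (@d n).

(** Only finitely many coordinates matter up to a given error. *)
Hypothesis d_tail : forall (x y : inv_lim p) m n, (m <= n)%N ->
  d (val x n) (val y n) <= Num.max (d (val x m) (val y m)) (half_pow R m).

Lemma le_lim_dist (x y : inv_lim p) n : d (val x n) (val y n) <= lim_dist x y.
Proof.
apply: ub_le_sup; last by exists n.
exists (Num.max (d (val x 0) (val y 0)) (half_pow R 0)) => _ [m _ <-].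
exact: d_tail.
Qed.

Lemma lim_dist_le (x y : inv_lim p) c :
  (forall n, d (val x n) (val y n) <= c) -> lim_dist x y <= c.
Proof.
move=> h; apply: sup_le_ub; first by exists (d (val x 0) (val y 0)), 0%N.
by move=> _ [n _ <-].
Qed.

Lemma lim_dist_metric : is_metric lim_dist.
Proof.
have dm n : is_metric (@d n) := (cd n).1.
split=> [x|x y xy|x y|x y z].
- apply/eqP; rewrite eq_le; apply/andP; split.
    by apply: lim_dist_le => n; have [-> _ _ _] := dm n.
  by have := le_lim_dist x x 0%N; have [-> _ _ _] := dm 0%N.
- apply: val_inj; apply: functional_extensionality_dep => n.
  have [_ d1 _ _] := dm n; apply: d1; apply/eqP.
  rewrite eq_le pseudometric_ge0 ?andbT; last exact: metric_pseudometric.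
  by rewrite -xy le_lim_dist.
- congr sup; apply/seteqP; split=> _ [n _ <-]; exists n => //;
    by have [_ _ -> _] := dm n.
- apply: lim_dist_le => n; have [_ _ _ dT] := dm n.
  by apply: (le_trans (dT _ (val y n) _)); apply: lerD; exact: le_lim_dist.
Qed.

Lemma inv_lim_compatible : compatible_metric lim_dist.
Proof.
apply: compatible_metric_intro; first exact: lim_dist_metric.
- move=> e e0; have [n hn] := half_pow_small (divr_gt0 e0 (@ltr0Sn R 1)).
  pose E m := [set uv : prod_topology X * prod_topology X |
    forall i, (i <= m)%N -> d (uv.1 i) (uv.2 i) < e / 2].
  have EE i : entourage [set uv : prod_topology X * prod_topology X |
      d (uv.1 i) (uv.2 i) < e / 2].
    pose D := [set xy : X i * X i | d xy.1 xy.2 < e / 2].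
    apply: (@prod_entourage_proj _ i D); apply/(compatible_entourageP _ (cd i)).
    by exists (e / 2) => //; rewrite divr_gt0.
  have entE m : entourage (E m).
    elim: m => [|m IH].
      by apply: filterS (EE 0%N) => uv h i; rewrite leqn0 => /eqP ->.
    apply: filterS (filterI IH (EE m.+1)) => uv [h1 h2] i.
    by rewrite leq_eqVlt => /orP[/eqP ->//|]; exact: h1.
  exists (E n) => // -[x y] /= h; apply: (@le_lt_trans _ _ (e / 2)); last by lra.
  apply: lim_dist_le => m; have [mn|/ltnW nm] := leqP m n; first exact/ltW/h.
  apply: (le_trans (d_tail _ _ nm)); rewrite ge_max (ltW hn) andbT.
  exact/ltW/h.
- move=> E [F entF FE].
  pose G := [set F : set (prod_topology X * prod_topology X) |
    exists2 e : R, 0 < e &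
      forall x y : inv_lim p, lim_dist x y < e -> F (val x, val y)].
  have FG : Filter G.
    split; first by exists 1.
      move=> P Q [e e0 hP] [q q0 hQ]; exists (Num.min e q).
        by rewrite lt_min e0.
      by move=> x y; rewrite lt_min => /andP[h1 h2]; split; [exact: hP|exact: hQ].
    by move=> P Q PQ [e e0 hP]; exists e => // x y xy; apply/PQ/hP.
  have [n C /(compatible_entourageP _ (cd n))[e e0 h]|e e0 h] :=
      prod_entourage_min FG _ entF.
    by exists e => // x y xy; apply: h; exact: (le_lt_trans (le_lim_dist _ _ n)).
  by exists e => // x y xy; exact/FE/h.
Qed.

End inverse_limit_metric.

Lemma inv_lim_metrizable (R : realType) (X : nat -> uniformType)
    (p : forall n, X n.+1 -> X n) :
  (forall n, metrizable R (X n)) -> metrizable R (inv_lim p).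
Proof.
move=> Xm; have d n := cid (Xm n).
pose d' n x y := Num.min (half_pow R n) (sval (d n) x y).
exists (lim_dist (p := p) d'); apply: inv_lim_compatible.
  by move=> n; apply: trunc_compatible; [exact: half_pow_gt0|exact: svalP (d n)].
move=> x y m n mn; rewrite le_max; apply/orP; right.
by apply: le_trans (half_pow_le R mn); rewrite /d' ge_min lexx.
Qed.

(** * Complete uniform ANRs are retracts of function spaces *)

Section function_space.
Variables (R : realType) (Y : Type).

Definition fun_space : Type := Y -> R.

Definition fun_dist (phi psi : fun_space) : R :=
  sup [set Num.min 1 `|phi s - psi s| | s in [set: Y]].

Lemma fun_dist_ge phi psi s : Num.min 1 `|phi s - psi s| <= fun_dist phi psi.
Proof.
apply: ub_le_sup; last by exists s.
by exists 1 => _ [t _ <-]; rewrite ge_min lexx.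
Qed.

Lemma fun_dist_empty phi psi : (Y -> False) -> fun_dist phi psi = 0.
Proof.
move=> no; rewrite /fun_dist; set S := (X in sup X).
suff -> : S = set0 by rewrite sup0.
by apply/seteqP; split=> // x [s _ _]; case: (no s).
Qed.

Lemma fun_dist_le phi psi c : 0 <= c ->
  (forall s, `|phi s - psi s| <= c) -> fun_dist phi psi <= c.
Proof.
move=> c0 h; have [[s _]|no] := pselect (exists s : Y, True).
  apply: sup_le_ub; first by exists (Num.min 1 `|phi s - psi s|), s.
  by move=> _ [t _ <-]; rewrite ge_min h orbT.
by rewrite fun_dist_empty// => s; apply: no; exists s.
Qed.

Lemma fun_dist_lt phi psi c : c <= 1 -> fun_dist phi psi < c ->
  forall s, `|phi s - psi s| < c.
Proof.
move=> c1 h s; have := le_lt_trans (fun_dist_ge phi psi s) h.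
by rewrite gt_min => /orP[/lt_le_trans/(_ c1)|//]; rewrite ltxx.
Qed.

Lemma fun_dist_ge0 phi psi : 0 <= fun_dist phi psi.
Proof.
have [[s _]|no] := pselect (exists s : Y, True).
  by apply: le_trans (fun_dist_ge phi psi s); rewrite le_min ler01/=.
by rewrite fun_dist_empty// => s; apply: no; exists s.
Qed.

Lemma fun_distxx phi : fun_dist phi phi = 0.
Proof.
apply/eqP; rewrite eq_le fun_dist_ge0 andbT; apply: fun_dist_le => // s.
by rewrite subrr normr0.
Qed.

Lemma fun_dist_eq phi psi : fun_dist phi psi = 0 -> phi = psi.
Proof.
move=> h; apply/funext => s; apply/eqP; rewrite -subr_eq0 -normr_eq0 eq_le.
rewrite normr_ge0 andbT; apply/ler_addgt0Pl => e e0; rewrite addr0.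
have := @fun_dist_lt phi psi (Num.min 1 e); rewrite h lt_min ltr01 e0 ge_min lexx.
by move=> /(_ isT isT s); rewrite lt_min => /andP[_ /ltW].
Qed.

Lemma fun_dist_sym phi psi : fun_dist phi psi = fun_dist psi phi.
Proof.
by congr sup; apply/seteqP; split=> _ [s _ <-]; exists s => //; rewrite distrC.
Qed.

Lemma fun_dist_triangle psi phi chi :
  fun_dist phi chi <= fun_dist phi psi + fun_dist psi chi.
Proof.
have [[s0 _]|no] := pselect (exists s : Y, True); last first.
  suff -> : phi = chi by rewrite fun_distxx addr_ge0 ?fun_dist_ge0.
  by apply/funext => s; case: no; exists s.
apply: sup_le_ub; first by exists (Num.min 1 `|phi s0 - chi s0|), s0.
move=> _ [s _ <-].
apply: le_trans (lerD (fun_dist_ge phi psi s) (fun_dist_ge psi chi s)).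
have := ler_distD (psi s) (phi s) (chi s).
have := normr_ge0 (phi s - psi s); have := normr_ge0 (psi s - chi s).
by case: (lerP 1 `|phi s - chi s|); case: (lerP 1 `|phi s - psi s|);
  case: (lerP 1 `|psi s - chi s|); move=> *; lra.
Qed.

HB.instance Definition _ := gen_eqMixin fun_space.
HB.instance Definition _ := gen_choiceMixin fun_space.
HB.instance Definition _ := isMetric.Build R fun_space
  fun_distxx fun_dist_eq fun_dist_sym fun_dist_triangle.

End function_space.

Section ANR_retract.
Variables (R : realType) (Y : uniformType) (d : Y -> Y -> R).
Hypothesis cd : compatible_metric d.

Let kur (y : Y) : fun_space R Y := d y.

Lemma kuratowski_short x y s : `|d x s - d y s| <= d x y.
Proof.
have [_ dC dT] := metric_pseudometric cd.1.
have := dT x y s; have := dT y x s; rewrite (dC y x) ler_norml => h1 h2.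
by apply/andP; split; lra.
Qed.

Lemma kuratowski_expand x y c :
  c <= 1 -> fun_dist (kur x) (kur y) < c -> d x y < c.
Proof.
move=> c1 h; have := fun_dist_lt c1 h y; have [d0 _ _] := metric_pseudometric cd.1.
rewrite /kur d0 subr0 ger0_norm// pseudometric_ge0//.
exact: metric_pseudometric cd.1.
Qed.

Lemma kuratowski_embedding : uniform_embedding kur.
Proof.
have dP := metric_pseudometric cd.1; have [d0 d1 dC dT] := cd.1.
have cF := @mdist_compatible R (fun_space R Y).
split.
- move=> x y xy; apply: d1; have -> : d x y = kur x y by [].
  by rewrite xy /kur d0.
- apply/(unif_continuous_uconP _ cd cF); apply: ucon_short => x y.
  apply: fun_dist_le; first exact: pseudometric_ge0.
  exact: kuratowski_short.
- move=> E /(compatible_entourageP _ cd)[e e0 he].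
  exists [set uv | fun_dist uv.1 uv.2 < Num.min 1 e].
    apply/(compatible_entourageP _ cF); exists (Num.min 1 e) => //.
    by rewrite lt_min ltr01.
  move=> x y /= h; apply: he.
  have /kuratowski_expand : Num.min 1 e <= 1 by rewrite ge_min lexx.
  by move=> /(_ _ _ h); rewrite lt_min => /andP[].
Qed.

Lemma kuratowski_closed : fast_complete d -> closed (range kur).
Proof.
have dP := metric_pseudometric cd.1; have [d0 _ dC dT] := cd.1.
move=> Yc phi cphi.
have /choice[u hu] n : exists y, forall s, `|phi s - d y s| < half_pow R n / 2.
  have e0 : 0 < half_pow R n / 2 by rewrite divr_gt0// half_pow_gt0.
  have [_ [[y _ <-]]] := cphi _ (nbhsx_ballx phi _ e0).
  rewrite ballEmdist/= => h; exists y; apply: fun_dist_lt h.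
  by have := half_pow_le1 R n => h1; lra.
have [|y hy] := Yc u.
  move=> n; have := ltW (hu n (u n.+1)); have := ltW (hu n.+1 (u n.+1)).
  rewrite d0 half_powS !ler_norml => /andP[_ h1] /andP[h2 _].
  by have := half_pow_gt0 R n => h3; lra.
exists y => //; apply/funext => s; apply/eqP.
rewrite -subr_eq0 -normr_eq0 eq_le normr_ge0 andbT.
apply: (@half_pow_bound _ _ _ 3) => // n; rewrite add0r /kur.
have := ltW (hu n s); have := kuratowski_short (u n) y s; have := hy n.
rewrite !ler_norml => h1 /andP[h2 h3] /andP[h4 h5].
by have := half_pow_gt0 R n => h6; apply/andP; split; lra.
Qed.

(** The definition of a uniform ANR is applied to the Kuratowski embedding; its
  image is closed because [Y] is complete. *)
Lemma ANR_kuratowski_retract (y0 : Y) :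
  fast_complete d -> uniform_ANR R Y -> kuratowski_retract d.
Proof.
move=> Yc [_ /(_ (fun_space R Y) kur)].
have cF := @mdist_compatible R (fun_space R Y).
move=> [|||N [d' cd' [e e0 eN]] [r [ru rr rid]]].
- by exists (@mdist R (fun_space R Y)).
- exact: kuratowski_embedding.
- exact: kuratowski_closed.
have [e1 e10 he1] : exists2 e1 : R, 0 < e1 & forall x y : fun_space R Y,
    fun_dist x y < e1 -> d' x y < e.
  apply/(compatible_entourageP [set xy | d' xy.1 xy.2 < e] cF).
  by apply/(compatible_entourageP _ cd'); exists e.
have /choice[g gP] (v : set_type N) : exists y, kur y = r v.
  by have [y _ <-] := rr v; exists y.
pose r' (phi : fun_space R Y) : Y := if insub phi is Some v then g v else y0.
have near (phi : fun_space R Y) : near_kuratowski d (e1 / 2) phi -> N phi.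
  move=> [y hy]; apply: (eN (kur y)); first by exists y.
  apply: he1; apply: (@le_lt_trans _ _ (e1 / 2)); last by lra.
  by apply: fun_dist_le => [|s]; [lra|rewrite distrC; exact: hy].
have r'E (phi : fun_space R Y) : N phi ->
    exists2 v : set_type N, val v = phi & r' phi = g v.
  move=> /mem_set Nphi; rewrite /r' insubT/=.
  by exists (Sub phi Nphi) => //; rewrite SubK.
exists (e1 / 2), r'; split; first by rewrite divr_gt0.
  move=> y; have [|v vy ->] := r'E (kur y).
    by apply: (eN (kur y)); [exists y|have [[-> _ _ _] _] := cd'].
  have [inj _ _] := kuratowski_embedding.
  by apply: inj; rewrite gP rid// vy; exists y.
move=> q q0.
have /(unif_continuous_uconP _ (subset_compatible N cF) cF) := ru.
move=> /(_ (Num.min 1 q)); rewrite lt_min ltr01 q0 => /(_ isT)[c c0 hc].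
exists (c / 2); first by rewrite divr_gt0.
move=> phi psi /near/r'E[v vphi ->] /near/r'E[v' vpsi ->] h.
have /kuratowski_expand : Num.min 1 q <= 1 by rewrite ge_min lexx.
move=> /(_ (g v) (g v')); rewrite !gP => H.
have : d (g v) (g v') < Num.min 1 q.
  apply: H; apply: hc => //; rewrite vphi vpsi.
  apply: (@le_lt_trans _ _ (c / 2)); last by lra.
  by apply: fun_dist_le => //; lra.
by rewrite lt_min => /andP[].
Qed.

End ANR_retract.

(** * Bonding maps *)

Section bonds.
Variables (X : nat -> uniformType) (p : forall n, X n.+1 -> X n).

Lemma bond_bond i j k (ij : (i <= j)%N) (jk : (j <= k)%N) (ik : (i <= k)%N)
  (x : X k) : bond p ij (bond p jk x) = bond p ik x.
Proof.
elim: k jk ik x => [|k IH] jk ik x.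
  have j0 : j = 0%N by apply/eqP; rewrite -leqn0.
  by subst j; rewrite bond_id (bool_irrelevance ij ik).
have [jk'|kj] := leqP j k.
  by rewrite (bondS p jk' jk) (bondS p (leq_trans ij jk') ik); exact: IH.
have jE : j = k.+1 by apply/eqP; rewrite eqn_leq jk.
by subst j; rewrite bond_id (bool_irrelevance ij ik).
Qed.

Lemma p_bond i j (ij : (i.+1 <= j)%N) (ij' : (i <= j)%N) (x : X j) :
  p (bond p ij x) = bond p ij' x.
Proof.
have -> : p (bond p ij x) = bond p (leqnSn i) (bond p ij x).
  by rewrite (bondS p (leqnn i)) bond_id.
exact: bond_bond.
Qed.

Lemma thread_p (x : inv_lim p) n : p (val x n.+1) = val x n.
Proof. by have := set_valP x; apply. Qed.

Lemma bond_thread (x : inv_lim p) i j (ij : (i <= j)%N) :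
  bond p ij (val x j) = val x i.
Proof.
elim: j ij => [|j IH] ij.
  have i0 : i = 0%N by apply/eqP; rewrite -leqn0.
  by subst i; rewrite bond_id.
have [ij'|ji] := leqP i j; first by rewrite (bondS p ij') thread_p.
have iE : i = j.+1 by apply/eqP; rewrite eqn_leq ij.
by subst i; rewrite bond_id.
Qed.

End bonds.

(** * Metrics for which the bonding maps are short *)

Section adapted_metric.
Variables (R : realType) (X : nat -> uniformType).
Variable p : forall n, X n.+1 -> X n.

(** The last clause makes the [n]-th coordinate of a thread determine the thread
  up to a distance of [2^-n]. *)
Definition short_bonds (rho : forall n, X n -> X n -> R) : Prop :=
  [/\ forall n, compatible_metric (@rho n),
      forall n x y, rho n x y <= 1,
      forall n x y, rho n (p x) (p y) <= rho n.+1 x y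
    & forall n x y, rho n.+1 x y <= Num.max (rho n (p x) (p y)) (half_pow R n)].

Variable d : forall n, X n -> X n -> R.

Fixpoint adapted_dist n : X n -> X n -> R :=
  match n with
  | 0 => fun x y => Num.min 1 (d x y)
  | m.+1 => fun x y =>
      Num.max (adapted_dist (p x) (p y)) (Num.min (half_pow R m.+1) (d x y))
  end.

Lemma adapted_short_bonds :
  (forall n, compatible_metric (@d n)) -> (forall n, unif_continuous (@p n)) ->
  short_bonds adapted_dist.
Proof.
move=> cd pu.
have cA n : compatible_metric (@adapted_dist n).
  elim: n => [|n IH]; first exact: trunc_compatible.
  have ct := trunc_compatible (half_pow_gt0 R n.+1) (cd n.+1).
  have [[a0 a1 aC aT] _] := IH; have [[b0 b1 bC bT] _] := ct.
  apply: compatible_metric_intro.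
  - split=> [x|x y|x y|x y z] /=.
    + by rewrite a0 b0 maxxx.
    + move=> h; apply: b1; apply/eqP; rewrite eq_le; apply/andP; split.
        by rewrite -h le_max lexx orbT.
      exact: pseudometric_ge0 (metric_pseudometric ct.1) _ _.
    + by rewrite aC bC.
    + rewrite ge_max; apply/andP; split.
        by apply: (le_trans (aT _ (p y) _)); apply: lerD; rewrite le_max lexx.
      by apply: (le_trans (bT _ y _)); apply: lerD; rewrite le_max lexx orbT.
  - move=> e e0; have /(unif_continuous_uconP _ (cd n.+1) IH) pu' := pu n.
    have [q q0 hq] := pu' e e0; apply/(compatible_entourageP _ (cd n.+1)).
    exists (Num.min q e) => [|x y]; first by rewrite lt_min q0.
    by rewrite lt_min /= => /andP[h1 h2]; rewrite gt_max hq// gt_min h2 orbT.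
  - move=> E /(compatible_entourageP _ ct)[e e0 h]; exists e => // x y /=.
    by rewrite gt_max => /andP[_]; exact: h.
split=> // [n x y|n x y|n x y] /=.
- elim: n x y => [|n IH] x y /=; first by rewrite ge_min lexx.
  by rewrite ge_max IH ge_min half_pow_le1.
- by rewrite le_max lexx.
- rewrite ge_max le_max lexx/= le_max; apply/orP; right.
  by rewrite ge_min half_pow_le.
Qed.

End adapted_metric.

Section short_sequence.
Variables (R : realType) (X : nat -> uniformType).
Variable p : forall n, X n.+1 -> X n.
Variable rho : forall n, X n -> X n -> R.
Hypothesis rhoS : short_bonds p rho.

Let cr n : compatible_metric (@rho n). Proof. by case: rhoS. Qed.
Let rP n : is_pseudometric (@rho n).
Proof. exact: metric_pseudometric (cr n).1. Qed.

Lemma bond_short i j (ij : (i <= j)%N) (x y : X j) :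
  rho (bond p ij x) (bond p ij y) <= rho x y.
Proof.
have [_ _ pS _] := rhoS; elim: j ij x y => [|j IH] ij x y.
  have i0 : i = 0%N by apply/eqP; rewrite -leqn0.
  by subst i; rewrite !bond_id.
have [ij'|ji] := leqP i j.
  by rewrite !(bondS p ij'); apply: le_trans (IH _ _ _) (pS _ _ _).
have iE : i = j.+1 by apply/eqP; rewrite eqn_leq ij.
by subst i; rewrite !bond_id.
Qed.

Lemma bond_ucon i j (ij : (i <= j)%N) (A : set (X j)) :
  ucon (@rho j) (@rho i) A (bond p ij).
Proof. by apply: ucon_short => x y; exact: bond_short. Qed.

Lemma thread_tail (x y : inv_lim p) m n : (m <= n)%N ->
  rho (val x n) (val y n) <= Num.max (rho (val x m) (val y m)) (half_pow R m).
Proof.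
have [_ _ _ rt] := rhoS; move=> /subnK <-; elim: (n - m)%N => [|k IH].
  by rewrite add0n le_max lexx.
rewrite addSn; apply: (le_trans (rt _ _ _)); rewrite !thread_p ge_max IH/=.
by rewrite le_max half_pow_le ?orbT// leq_addl.
Qed.

Let D := lim_dist (p := p) rho.

Lemma lim_dist_compatible : compatible_metric D.
Proof. by apply: inv_lim_compatible => //; exact: thread_tail. Qed.

Let DP : is_pseudometric D.
Proof. exact: metric_pseudometric lim_dist_compatible.1. Qed.

Lemma coord_le_lim_dist (x y : inv_lim p) n : rho (val x n) (val y n) <= D x y.
Proof. by apply: le_lim_dist; exact: thread_tail. Qed.

Lemma coord_ucon n (A : set (inv_lim p)) :
  ucon D (@rho n) A (fun x => val x n).
Proof. by apply: ucon_short => x y; exact: coord_le_lim_dist. Qed.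

Lemma lim_dist_max (x y : inv_lim p) n :
  D x y <= Num.max (rho (val x n) (val y n)) (half_pow R n).
Proof.
apply: lim_dist_le => m; have [mn|/ltnW nm] := leqP m n; last exact: thread_tail.
by rewrite -(bond_thread x mn) -(bond_thread y mn) le_max bond_short.
Qed.

(** A sequence of points which is almost a thread is close to a thread: in each
  [X n] the images of the later points form a Cauchy sequence. *)
Lemma almost_thread (v : forall n, X n) :
  (forall n, fast_complete (@rho n)) ->
  (forall n, rho (p (v n.+1)) (v n) <= half_pow R n) ->
  exists x : inv_lim p, forall n, rho (v n) (val x n) <= 2 * half_pow R n.
Proof.
move=> rc hv.
have lim n : {x : X n | forall b (nb : (n <= b)%N),
    rho (bond p nb (v b)) x <= 2 * half_pow R b}.
  apply: cid; pose u b := bond p (leq_maxl n b) (v (maxn n b)).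
  have uE b c (nc : (n <= c)%N) : maxn n b = c -> u b = bond p nc (v c).
    by move=> E; subst c; rewrite /u (bool_irrelevance nc (leq_maxl n b)).
  have [|x hx] := rc n u; last first.
    exists x => b nb; apply: le_trans (hx b).
    by rewrite (uE b b nb)//; apply/maxn_idPr.
  move=> b; have [r0 rC _] := rP n; have [nb|bn] := leqP n b.
    rewrite (uE b b nb) ?(uE b.+1 b.+1 (leqW nb)); try exact/maxn_idPr/leqW.
      rewrite rC (bondS p nb); apply: (le_trans (bond_short _ _ _)).
      exact: hv.
    exact/maxn_idPr.
  rewrite (uE b n (leqnn n)); last exact/maxn_idPl/ltnW.
  rewrite (uE b.+1 n (leqnn n)); last exact/maxn_idPl.
  by rewrite r0 ltW// half_pow_gt0.
pose x n := sval (lim n); have xP n := svalP (lim n).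
have xT : threads p x.
  move=> n; have [d0 d1 dC dT] := (cr n).1; apply: d1; apply/eqP.
  rewrite eq_le (pseudometric_ge0 (rP n)) andbT.
  apply: (@half_pow_bound _ _ _ 4) => // a; rewrite add0r.
  have nb : (n.+1 <= a + n.+1)%N by exact: leq_addl.
  have h1 := xP n.+1 _ nb; have h2 := xP n _ (ltnW nb).
  have [_ _ pS _] := rhoS; have h3 := pS n (bond p nb (v (a + n.+1)%N)) (x n.+1).
  rewrite (p_bond p nb (ltnW nb)) in h3.
  have := dT (p (x n.+1)) (bond p (ltnW nb) (v (a + n.+1)%N)) (x n).
  have := half_pow_le R (leq_addr n.+1 a).
  rewrite (dC (p (x n.+1)) (bond _ _ _)) => h4 h5.
  by rewrite -/(x n) -/(x n.+1) in h1 h2; lra.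
exists (exist _ (x : prod_topology X) (mem_set xT)) => n /=.
by have := xP n n (leqnn n); rewrite bond_id.
Qed.

End short_sequence.

(** * Extending maps into an inverse limit *)

Section approximate_domination.
Variables (R : realType) (X : nat -> uniformType).
Variable p : forall n, X n.+1 -> X n.
Variable rho : forall n, X n -> X n -> R.

(** The maps of condition (b) for given indices. Times range over all the reals,
  which spares a subtype, but only those between [0] and [1] are constrained. *)
Definition homotopy_factors (a : R) (i j k l : nat) (ij : (i <= j)%N)
    (ik : (i <= k)%N) (il : (i <= l)%N) (jl : (j <= l)%N) (kl : (k <= l)%N)
    (s : X j -> X k) (h : X l -> R -> X k) : Prop :=
  [/\ ucon (@rho j) (@rho k) setT s,
      forall x, rho (bond p ik (s x)) (bond p ij x) <= a,
      ucon (pdist (@rho l) (@rdist R)) (@rho k) [set u | 0 <= u.2 <= 1]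
        (fun u => h u.1 u.2),
      forall x, h x 0 = bond p kl x /\ h x 1 = s (bond p jl x)
    & forall x t, 0 <= t <= 1 -> rho (bond p ik (h x t)) (bond p il x) <= a].

Definition approx_dominated (a : nat -> R) : Prop :=
  forall i, exists (j : nat) (ij : (i <= j)%N), forall k (jk : (j < k)%N),
    exists (l : nat) (ik : (i <= k)%N) (il : (i <= l)%N) (jl : (j <= l)%N)
      (kl : (k <= l)%N) s h, homotopy_factors (a i) ij ik il jl kl s h.

End approximate_domination.

Lemma dependent_choice (T : nat -> Type) (Q : forall n, T n -> Prop)
    (Rel : forall n, T n -> T n.+1 -> Prop) :
  (exists x : T 0%N, Q 0%N x) ->
  (forall n x, Q n x -> exists2 y, Q n.+1 y & Rel n x y) ->
  exists f : forall n, T n, forall n, Q n (f n) /\ Rel n (f n) (f n.+1).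
Proof.
move=> /cid[x0 Qx0] step.
have nxt n (x : {x : T n | Q n x}) :
    {y : {y : T n.+1 | Q n.+1 y} | Rel n (sval x) (sval y)}.
  by case: x => x Qx /=; have /cid2[y Qy xy] := step n x Qx; exists (exist _ y Qy).
pose F := fix F n : {x : T n | Q n x} :=
  match n with 0%N => exist _ x0 Qx0 | m.+1 => sval (nxt m (F m)) end.
exists (fun n => sval (F n)) => n; split; first exact: svalP (F n).
exact: svalP (nxt n (F n)).
Qed.

Section extension.
Variables (R : realType) (X : nat -> uniformType).
Variable p : forall n, X n.+1 -> X n.
Variable rho : forall n, X n -> X n -> R.
Hypothesis rhoS : short_bonds p rho.
Hypothesis rho_retract : forall n, kuratowski_retract (@rho n).

Let cr n : compatible_metric (@rho n). Proof. by case: rhoS. Qed.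
Let rP n : is_pseudometric (@rho n).
Proof. exact: metric_pseudometric (cr n).1. Qed.
Let r1 n x y : @rho n x y <= 1. Proof. by case: rhoS => _ h _ _; exact: h. Qed.

Let D := lim_dist (p := p) rho.

Variables (Z : Type) (dZ : Z -> Z -> R) (A : set Z) (g : Z -> inv_lim p).
Hypothesis dZP : is_pseudometric dZ.
Hypothesis A0 : A !=set0.
Hypothesis gu : ucon dZ D A g.

Let w := set_dist dZ A.
Let wL x y : `|w x - w y| <= dZ x y. Proof. exact: set_dist_short. Qed.
Let w0 a : A a -> w a = 0. Proof. exact: set_dist0. Qed.

Lemma agreeing_maps_close (Y : Type) (d : Y -> Y -> R) (B : set Z)
    (P Q : Z -> Y) (e : R) :
  is_pseudometric d -> A `<=` B -> ucon dZ d B P -> ucon dZ d B Q ->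
  (forall a, A a -> P a = Q a) -> 0 < e ->
  exists2 c : R, 0 < c & forall z, B z -> w z < c -> d (P z) (Q z) < e.
Proof.
move=> [_ dC dT] AB Pu Qu PQ e0.
have e20 : 0 < e / 2 by rewrite divr_gt0.
have [q q0 hq] := Pu _ e20; have [q' q'0 hq'] := Qu _ e20.
exists (Num.min q q') => [|z Bz]; first by rewrite lt_min q0.
move=> /(set_dist_lt A0)[a Aa]; rewrite lt_min => /andP[h h'].
have h1 := hq z a Bz (AB _ Aa) h; have h2 := hq' z a Bz (AB _ Aa) h'.
by rewrite -(PQ a Aa) dC in h2; have := dT (P z) (P a) (Q z) => h3; lra.
Qed.

Lemma coord_extension n :
  exists (F : Z -> X n) (c : R),
    [/\ 0 < c, forall a, A a -> F a = val (g a) n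
      & ucon dZ (@rho n) [set z | w z < c] F].
Proof.
apply: (@kuratowski_retract_extension _ _ _ _ _ _ (fun z => val (g z) n)) => //.
by apply: ucon_comp gu (coord_ucon rhoS n setT) _.
Qed.

(** One step of the construction of the extension of [g]: an extension of its
  [j]-th coordinate is first deformed near [A] into the image of an extension
  of the [l]-th coordinate, then sent to [X k] by [s], and finally deformed
  near [A] by the homotopy [h] into an extension of the [k]-th coordinate. *)
Lemma lift_extension (a : R) i j k l (ij : (i <= j)%N) (ik : (i <= k)%N)
    (il : (i <= l)%N) (jl : (j <= l)%N) (kl : (k <= l)%N) s h
    (N : set Z) (P : Z -> X j) :
  0 < a -> homotopy_factors p rho a ij ik il jl kl s h ->
  A `<=` N -> ucon dZ (@rho j) N P -> (forall z, A z -> P z = val (g z) j) ->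
  exists P' : Z -> X k,
    [/\ ucon dZ (@rho k) N P', forall z, A z -> P' z = val (g z) k
      & forall z, N z -> rho (bond p ik (P' z)) (bond p ij (P z)) <= 2 * a].
Proof.
move=> a0 [su sclose hu hends hclose] AN Pu PA.
have [F [c [c0 FA Fu]]] := coord_extension l.
pose Q z := bond p jl (F z); pose B := [set z | N z /\ w z < c].
have Qu : ucon dZ (@rho j) B Q.
  by apply: (ucon_comp (ucon_sub _ Fu) (bond_ucon rhoS jl setT)) => // z [].
have [eta [gam gamP]] := kuratowski_retract_equiconnected (rP j) (rho_retract j).
have [q [q0 q_eta hq]] := equiconnecting_close (rP j) gamP a0.
have [eta0 gam0 gam1 gamxx gamu] := gamP.
have AB : A `<=` B by move=> z Az; split; [exact: AN|rewrite w0].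
have PQ z : A z -> P z = Q z by move=> Az; rewrite /Q FA// bond_thread PA.
have PuB : ucon dZ (@rho j) B P by apply: ucon_sub Pu => z [].
have [c1 c10 hc1] := agreeing_maps_close (rP j) AB PuB Qu PQ q0.
pose c2 := Num.min c c1.
have c20 : 0 < c2 by rewrite lt_min c0.
have [||P1 [P1u P1Q P1P]] := glue_homotopy (K := fun z => gam (P z) (Q z)) wL Pu c20.
- pose U := [set u : Z * R | [/\ N u.1, w u.1 < c2 & 0 <= u.2 <= 1]].
  apply: (ucon_comp (f := fun u : Z * R => (P u.1, Q u.1, u.2)) _ gamu).
    have UB : forall u, U u -> B u.1.
      by move=> [z t] [/= Nz]; rewrite lt_min => /andP[].
    apply: ucon_pair; last exact: ucon_snd.
    by apply: ucon_pair; apply: (ucon_comp (ucon_fst _ _ U)) UB.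
  move=> [z t] [/= Nz]; rewrite lt_min => /andP[wc wc1] t01; split=> //=.
  by apply: lt_le_trans q_eta; exact: hc1.
- by move=> z Nz _; rewrite gam0.
have P1close z : N z -> rho (P1 z) (P z) <= a.
  move=> Nz; case: (P1P z) => [->|[]].
    by have [-> _ _] := rP j; exact: ltW.
  rewrite lt_min => /andP[wc wc1] [t t01 ->]; apply/ltW/hq => //.
  exact: hc1.
have c30 : 0 < c2 / 3 by rewrite divr_gt0.
have sP1u : ucon dZ (@rho k) N (s \o P1) by apply: ucon_comp P1u su _.
have [||P' [P'u P'1 P'P]] :=
    glue_homotopy (K := fun z t => h (F z) (1 - t)) wL sP1u c30.
- pose U := [set u : Z * R | [/\ N u.1, w u.1 < c2 / 3 & 0 <= u.2 <= 1]].
  apply: (ucon_comp (f := fun u : Z * R => (F u.1, 1 - u.2)) _ hu).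
    apply: ucon_pair.
      apply: (ucon_comp (ucon_fst _ _ U) Fu) => -[z t] [/= Nz wz _].
      have : c2 <= c by rewrite ge_min lexx.
      by move=> h1; lra.
    apply: (ucon_comp (g := fun t => 1 - t) (ucon_snd _ _ U)
              (ucon_short setT _)) => // x y.
    by rewrite /rdist distrC; have -> : 1 - y - (1 - x) = x - y by lra.
  by move=> [z t] [/= _ _ /andP[t0 t1]]; apply/andP; split; lra.
- move=> z Nz wz; rewrite subr0 /=; have [_ ->] := hends (F z).
  by rewrite P1Q ?gam1// ltW.
exists P'; split=> // z zA.
  rewrite P'1 ?w0 ?divr_ge0 ?ltW// subrr; have [-> _] := hends (F z).
  by rewrite FA// bond_thread.
have [_ rC rT] := rP i.
have h1 : rho (bond p ij (P1 z)) (bond p ij (P z)) <= a.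
  by apply: le_trans (bond_short rhoS _ _ _) (P1close z zA).
suff : rho (bond p ik (P' z)) (bond p ij (P1 z)) <= a.
  by have := rT (bond p ik (P' z)) (bond p ij (P1 z)) (bond p ij (P z)) => h2 h3; lra.
case: (P'P z) => [->|[wz [t /andP[t0 t1] ->]]]; first exact: sclose.
have -> : bond p ij (P1 z) = bond p il (F z).
  by rewrite P1Q ?gam1 ?(ltW wz)// /Q (bond_bond p _ _ il).
by apply: hclose; apply/andP; split; lra.
Qed.

(** The extension of [g] is the limit of the sequence of extensions of its
  coordinates given by the previous lemma, all of them defined on the same
  neighbourhood of [A]. *)
Lemma inv_lim_extension :
  (forall n, fast_complete (@rho n)) ->
  approx_dominated p rho (fun i => half_pow R i.+1) ->
  exists (G : Z -> inv_lim p) (c : R),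
    [/\ 0 < c, forall a, A a -> G a = g a & ucon dZ D [set z | w z < c] G].
Proof.
move=> rc dom.
have /choice[jj jjP] := dom.
pose I n := iter n (fun i => (jj i).+1) 0%N; pose J n := jj (I n).
have IJ n : (I n <= J n)%N by case: (jjP (I n)).
have JJ n : (J n < J n.+1)%N by exact: IJ n.+1.
have nI n : (n <= I n)%N.
  by elim: n => // n IH; exact: leq_trans IH (IJ n).
have nJ n : (n <= J n)%N by exact: leq_trans (nI n) (IJ n).
have IJS n : (I n <= J n.+1)%N by exact: leq_trans (IJ n) (ltnW (JJ n)).
have [F [c [c0 FA Fu]]] := coord_extension (J 0%N).
pose N := [set z | w z < c].
have AN : A `<=` N by move=> a Aa; rewrite /N/= w0.
have [||P PP] := @dependent_choice (fun n => Z -> X (J n))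
  (fun n P => ucon dZ (@rho (J n)) N P /\ forall z, A z -> P z = val (g z) (J n))
  (fun n P P' => forall z, N z ->
     rho (bond p (IJS n) (P' z)) (bond p (IJ n) (P z)) <= half_pow R (I n)).
- by exists F.
- move=> n P [Pu PA]; have [ij /(_ (J n.+1) (JJ n))] := jjP (I n).
  move=> [l [ik [il [jl [kl [s [h sh]]]]]]].
  have [P' [P'u P'A P'P]] :=
    lift_extension (half_pow_gt0 R (I n).+1) sh AN Pu PA.
  exists P' => // z Nz; rewrite (bool_irrelevance (IJS n) ik).
  rewrite (bool_irrelevance (IJ n) ij); apply: (le_trans (P'P z Nz)).
  by rewrite half_powS; lra.
pose v z n := bond p (nJ n) (P n z).
have vN z n : N z -> rho (p (v z n.+1)) (v z n) <= half_pow R n.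
  move=> Nz; have nJS : (n <= J n.+1)%N := leq_trans (nI n) (IJS n).
  rewrite /v (p_bond p _ nJS) -(bond_bond p (nI n) (IJS n)).
  rewrite -(bond_bond p (nI n) (IJ n)).
  apply: (le_trans (bond_short rhoS _ _ _)).
  have [_ /(_ z Nz) h] := PP n; apply: (le_trans h).
  exact: half_pow_le.
have /choice[G GP] z : exists x : inv_lim p, N z ->
    forall n, rho (v z n) (val x n) <= 2 * half_pow R n.
  have [Nz|nN] := pselect (N z); last by exists (g z).
  have [x hx] := almost_thread rhoS rc (fun n => vN z n Nz).
  by exists x.
have cD := lim_dist_compatible rhoS.
have DP := metric_pseudometric cD.1.
exists G, c; split=> // [a Aa|e e0].
  have [_ d1 _ _] := cD.1; apply: d1; apply/eqP.
  rewrite eq_le (pseudometric_ge0 DP) andbT.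
  apply: (@half_pow_bound _ _ _ 2) => // n; rewrite add0r.
  apply: (le_trans (lim_dist_max rhoS _ _ n)); rewrite ge_max; apply/andP; split.
    have [[_ PA] _] := PP n; have := GP a (AN _ Aa) n.
    by rewrite /v PA// bond_thread; have [_ -> _] := rP n.
  by have := half_pow_gt0 R n => h; lra.
have [n hn] := half_pow_small (divr_gt0 e0 (@ltr0Sn R 7)).
have [[Pu _] _] := PP n.
have e20 : 0 < e / 2 by rewrite divr_gt0.
have [q q0 hq] := Pu _ e20; exists q => // x y Nx Ny xy.
have h := hq x y Nx Ny xy.
apply: (le_lt_trans (lim_dist_max rhoS _ _ n)); rewrite gt_max; apply/andP; split.
  have [_ rC rT] := rP n.
  have h1 := GP x Nx n; have h2 := GP y Ny n.
  have h3 := le_lt_trans (bond_short rhoS (nJ n) (P n x) (P n y)) h.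
  have := rT (val (G x) n) (v x n) (val (G y) n).
  have := rT (v x n) (v y n) (val (G y) n).
  rewrite (rC (val (G x) n) (v x n)) => h4 h5.
  rewrite -/(v x n) -/(v y n) in h3; lra.
by have := half_pow_gt0 R n => h'; lra.
Qed.

End extension.

(** * Convergent sequences *)

Section convergence.
Variables (R : realType) (X : nat -> uniformType).
Variable p : forall n, X n.+1 -> X n.

Lemma top_entourage n (E : set (X n * X n)) : entourage E ->
  entourage [set ab : dunion X n * dunion X n |
    forall x y, ab.1 = top_summand x -> ab.2 = top_summand y -> E (x, y)].
Proof.
case: n E => [|n] E entE /=.
  by apply: filterS entE => -[a b] Eab x y /= <- <-.
split; last by apply: filterS (@entourageT _).
by apply: filterS entE => -[a b] Eab x y /= [<-] [<-].
Qed.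

(** The coordinates of the point that corresponds to [x] in the copy of [X j]
  contained in [lim_union p]: they pass to smaller summands below [j] and stay
  in [X j] above. *)
Fixpoint summand_coord j (x : X j) (n : nat) : dunion X n :=
  match n with
  | 0 => bond p (leq0n j) x
  | m.+1 => match leqP m.+1 j with
            | LeqNotGtn le => inl (bond p le x)
            | GtnNotLeq _ => inr (summand_coord x m)
            end
  end.

Lemma summand_coord_le j (x : X j) n (nj : (n <= j)%N) :
  summand_coord x n = top_summand (bond p nj x).
Proof.
case: n nj => [|n] nj /=; first by rewrite (bool_irrelevance nj (leq0n j)).
case: leqP => [le|lt]; first by rewrite (bool_irrelevance nj le).
by move: lt; rewrite ltnNge nj.
Qed.

Lemma summand_coord_gt j (x : X j) n : (j <= n)%N ->
  summand_coord x n.+1 = inr (summand_coord x n).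
Proof. by move=> jn /=; case: leqP => // le; move: jn; rewrite leqNgt le. Qed.

Lemma summand_coord_thread j (x : X j) : threads (dunion_bond p) (summand_coord x).
Proof.
move=> n; have [jn|nj] := leqP j n; first by rewrite summand_coord_gt.
rewrite (summand_coord_le x nj) (summand_coord_le x (ltnW nj)) /=.
by rewrite (p_bond p nj (ltnW nj)).
Qed.

Variable rho : forall n, X n -> X n -> R.
Hypothesis cr : forall n, compatible_metric (@rho n).

(** The points of [lim_union p] whose [m]-th coordinate, if it lies in [X m], is
  close to the [m]-th coordinate of a thread form a uniform neighbourhood of the
  limit, because a single coordinate is uniformly continuous and [X m] is a
  uniformly open summand; convergence is applied to this set. *)
Lemma convergent_close : convergent p R -> forall m e, 0 < e ->
  exists J, forall j (mj : (m <= j)%N), (J <= j)%N -> forall x : X j,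
    exists y : inv_lim p, rho (bond p mj x) (val y m) < e.
Proof.
move=> conv m e e0.
pose N := [set u : lim_union p | forall x : X m, val u m = top_summand x ->
  exists y : inv_lim p, rho x (val y m) < e].
have [|J _ hJ] := conv N.
  have [d cd] : metrizable R (lim_union p).
    by apply: inv_lim_metrizable => n; apply: dunion_metrizable => k; exists (@rho k).
  have entE : entourage [set xy : X m * X m | rho xy.1 xy.2 < e].
    by apply/(compatible_entourageP _ (cr m)); exists e.
  have /(compatible_entourageP _ cd)[q q0 hq] : entourage
      [set uv : lim_union p * lim_union p | forall x y,
        val uv.1 m = top_summand x -> val uv.2 m = top_summand y -> rho x y < e].
    eexists; first exact: prod_entourage_proj (top_entourage entE).
    by move=> uv.
  exists d => //; exists q => // u v [y uy] uv x vx; exists y.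
  have [[_ _ rC _] _] := cr m; rewrite rC.
  by apply: (hq u v uv) => //; exact: uy.
exists J => j mj Jj x.
pose u : lim_union p := exist _ (summand_coord x : prod_topology (dunion X))
  (mem_set (summand_coord_thread x)).
suff : summand_part (p := p) j u.
  by move=> /(hJ j Jj); apply; rewrite /= (summand_coord_le x mj).
split; first by exists x; rewrite /= (summand_coord_le x (leqnn j)) bond_id.
by move=> n jn; exact: (summand_coord_gt x jn).
Qed.

End convergence.

(** * Factorizations through the limit *)

Section domination.
Variables (R : realType) (X : nat -> uniformType).
Variable p : forall n, X n.+1 -> X n.
Variable rho : forall n, X n -> X n -> R.
Hypothesis rhoS : short_bonds p rho.

Let cr n : compatible_metric (@rho n). Proof. by case: rhoS. Qed.
Let rP n : is_pseudometric (@rho n).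
Proof. exact: metric_pseudometric (cr n).1. Qed.

Let D := lim_dist (p := p) rho.
Let DP : is_pseudometric D.
Proof. exact: metric_pseudometric (lim_dist_compatible rhoS).1. Qed.

(** A point [x] of [X m] determines the function [y |-> rho m x y_m] on the
  limit, which is almost the distance to [y] when [x] is close to [y_m]; the
  retraction turns it into a point of the limit. *)
Lemma near_retraction : kuratowski_retract D -> forall e b, 0 < e -> 0 < b ->
  exists kap : R, [/\ 0 < kap, kap <= b
    & forall m, half_pow R m < kap -> exists r : X m -> inv_lim p,
       (forall x (y : inv_lim p), rho x (val y m) < kap -> D (r x) y < e) /\
       ucon (@rho m) D [set x | exists y : inv_lim p, rho x (val y m) < kap] r].
Proof.
move=> [e0 [r [e00 rK ru]]] e b e_gt0 b0; have [q q0 hq] := ru e e_gt0.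
have [D0 DC DT] := DP.
pose kap := Num.min (Num.min b (e0 / 2)) (q / 2); exists kap.
have kape0 : kap <= e0 / 2 by rewrite /kap !ge_min lexx orbT.
have kapq : kap <= q / 2 by rewrite /kap !ge_min lexx !orbT.
split; first by rewrite !lt_min b0 !divr_gt0.
  by rewrite /kap !ge_min lexx.
move=> m hm; pose E x (y : inv_lim p) := rho x (val y m).
have [_ rC rT] := rP m.
have EE x x' s : `|E x s - E x' s| <= rho x x'.
  have := rT x x' (val s m); have := rT x' x (val s m).
  by rewrite (rC x' x) ler_norml /E => h1 h2; apply/andP; split; lra.
have ED x (y s : inv_lim p) : rho x (val y m) < kap -> `|E x s - D y s| <= 2 * kap.
  move=> xy; have := EE x (val y m) s.
  have := coord_le_lim_dist rhoS y s m.
  have : D y s <= rho (val y m) (val s m) + half_pow R m.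
    apply: (le_trans (lim_dist_max rhoS y s m)).
    have := pseudometric_ge0 (rP m) (val y m) (val s m).
    by have := half_pow_gt0 R m => *; rewrite ge_max; apply/andP; split; lra.
  by rewrite !ler_norml /E -/D => h1 h2 /andP[h3 h4]; apply/andP; split; lra.
have nearE x (y : inv_lim p) : rho x (val y m) < kap -> near_kuratowski D e0 (E x).
  by move=> xy; exists y => s; apply: (le_trans (ED x y s xy)); lra.
exists (fun x => r (E x)); split=> [x y xy|c c0].
  rewrite -(rK y); apply: hq; [exact: nearE xy| |].
    by exists y => s; rewrite subrr normr0 ltW.
  by move=> s; apply: (le_trans (ED x y s xy)); lra.
have [q' q'0 hq'] := ru c c0; exists q' => // x x' [y xy] [y' xy'] xx'.
apply: hq'; [exact: nearE xy|exact: nearE xy'|] => s.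
by apply: (le_trans (EE _ _ _)); exact: ltW.
Qed.

(** The map [s] passes through the limit, via the retraction; so do the stages
  of the homotopy, which first moves [X l] in [X k] to its image in the limit,
  and then goes on inside the limit. *)
Lemma retract_approx_dominated :
  (forall n, kuratowski_retract (@rho n)) -> kuratowski_retract D ->
  (forall m e, 0 < e -> exists J, forall j (mj : (m <= j)%N), (J <= j)%N ->
    forall x : X j, exists y : inv_lim p, rho (bond p mj x) (val y m) < e) ->
  forall a : nat -> R, (forall i, 0 < a i) -> approx_dominated p rho a.
Proof.
move=> Xr Lr conv a a0 i; set e := a i.
have e0 : 0 < e by exact: a0.
have [_ DC DT] := DP.
have [eta [gam gamP]] := kuratowski_retract_equiconnected DP Lr.
have e40 : 0 < e / 4 by rewrite divr_gt0.
have [q [q0 q_eta hq]] := equiconnecting_close DP gamP e40.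
pose e' := Num.min (e / 4) (q / 2).
have e'0 : 0 < e' by rewrite lt_min e40 divr_gt0.
have e'e : e' <= e / 4 by rewrite ge_min lexx.
have e'q : e' <= q / 2 by rewrite ge_min lexx orbT.
have [kap [kap0 kape hkap]] := near_retraction Lr e'0 e40.
have [m0 hm0] := half_pow_small kap0.
pose m := maxn m0 i; have im : (i <= m)%N := leq_maxr _ _.
have [|r [rclose ru]] := hkap m.
  by apply: le_lt_trans hm0; apply: half_pow_le; exact: leq_maxl.
have [J hJ] := conv m kap kap0.
pose j := maxn m J; have mj : (m <= j)%N := leq_maxl _ _.
have ij : (i <= j)%N := leq_trans im mj.
exists j, ij => k jk; have ik : (i <= k)%N := leq_trans ij (ltnW jk).
pose s x := val (r (bond p mj x)) k.
have rju (T : Type) (dT : T -> T -> R) (U : set T) (f : T -> X j) :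
    ucon dT (@rho j) U f -> ucon dT D U (fun x => r (bond p mj (f x))).
  move=> fu; apply: (ucon_comp (g := r \o bond p mj) fu) (fun _ _ => Logic.I).
  by apply: ucon_comp (bond_ucon rhoS mj setT) ru _ => x _; apply: hJ; exact: leq_maxr.
have [etak [gamk gamkP]] := kuratowski_retract_equiconnected (rP k) (Xr k).
have [qk [qk0 qk_eta hqk]] := equiconnecting_close (rP k) gamkP e40.
pose b' := Num.min kap (qk / 2).
have b'0 : 0 < b' by rewrite lt_min kap0 divr_gt0.
pose e'' := Num.min e' (qk / 2).
have e''0 : 0 < e'' by rewrite lt_min e'0 divr_gt0.
have e''e : e'' <= e' by rewrite ge_min lexx.
have e''q : e'' <= qk / 2 by rewrite ge_min lexx orbT.
have [kap' [kap'0 kap'b hkap']] := near_retraction Lr e''0 b'0.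
have kap'k : kap' <= kap by apply: (le_trans kap'b); rewrite ge_min lexx.
have kap'q : kap' <= qk / 2 by apply: (le_trans kap'b); rewrite ge_min lexx orbT.
have [m0' hm0'] := half_pow_small kap'0.
pose m' := maxn m0' k; have km' : (k <= m')%N := leq_maxr _ _.
have [|r' [r'close r'u]] := hkap' m'.
  by apply: le_lt_trans hm0'; apply: half_pow_le; exact: leq_maxl.
have [J' hJ'] := conv m' kap' kap'0.
pose l := maxn m' J'; have m'l : (m' <= l)%N := leq_maxl _ _.
have kl : (k <= l)%N := leq_trans km' m'l.
have jl : (j <= l)%N := leq_trans (ltnW jk) kl.
have il : (i <= l)%N := leq_trans ij jl.
have ml : (m <= l)%N := leq_trans mj jl.
have hl x : exists y : inv_lim p, rho (bond p m'l x) (val y m') < kap'.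
  by apply: hJ'; exact: leq_maxr.
have r'lu (U : set (X l)) : ucon (@rho l) D U (r' \o bond p m'l).
  by apply: ucon_comp (bond_ucon rhoS m'l U) r'u _ => x _; exact: hl.
have down n (nm' : (n <= m')%N) (nl : (n <= l)%N) x (y : inv_lim p) :
    rho (bond p m'l x) (val y m') < kap' -> rho (bond p nl x) (val y n) < kap'.
  apply: le_lt_trans; rewrite -(bond_bond p nm' m'l) -(bond_thread y nm').
  exact: bond_short.
have jm' : (j <= m')%N := leq_trans (ltnW jk) km'.
have mm' : (m <= m')%N := leq_trans mj jm'.
have im' : (i <= m')%N := leq_trans ij jm'.
pose H1 x t := gamk (bond p kl x) (val (r' (bond p m'l x)) k) t.
pose H2 x t := gam (r' (bond p m'l x)) (r (bond p mj (bond p jl x))) t.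
have close1 x : rho (bond p kl x) (val (r' (bond p m'l x)) k) < qk.
  have [y xy] := hl x; have := coord_le_lim_dist rhoS y (r' (bond p m'l x)) k.
  have [_ rC rT] := rP k; have := rT (bond p kl x) (val y k) (val (r' (bond p m'l x)) k).
  have := down k km' kl x y xy; have := r'close _ _ xy; rewrite DC /D => h1 h2 h3 h4.
  lra.
have rclose' x (y : inv_lim p) : rho (bond p m'l x) (val y m') < kap' ->
    D (r (bond p mj (bond p jl x))) y < e'.
  move=> xy; apply: rclose; rewrite (bond_bond p mj jl ml).
  exact: lt_le_trans (down m mm' ml x y xy) kap'k.
have close2 x : D (r' (bond p m'l x)) (r (bond p mj (bond p jl x))) < q.
  have [y xy] := hl x; have h1 := r'close _ _ xy; have h2 := rclose' x y xy.
  have := DT (r' (bond p m'l x)) y (r (bond p mj (bond p jl x))).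
  by rewrite (DC y) => h3; lra.
pose U := [set u : X l * R | 0 <= u.2 <= 1].
have clampu c0 c1 : 0 < c0 ->
    ucon (pdist (@rho l) (@rdist R)) (@rdist R) U (fun u => clamp (c0 * u.2 - c1)).
  move=> c00; apply: (@ucon_lipschitz _ _ _ _ _ _ _ c0) => // x y _ _.
  apply: (le_trans (clamp_short _ _)).
  have -> : c0 * x.2 - c1 - (c0 * y.2 - c1) = c0 * (x.2 - y.2) by lra.
  rewrite normrM (gtr0_norm c00) ler_pM2l// /pdist /rdist le_max lexx.
  by rewrite orbT.
have fstu : ucon (pdist (@rho l) (@rdist R)) (@rho l) U fst by exact: ucon_fst.
have H1u : ucon (pdist (@rho l) (@rdist R)) (@rho k) U
    (fun u => H1 u.1 (clamp (3 * u.2 - 0))).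
  have [_ _ _ _ gu] := gamkP.
  apply: (ucon_comp (f := fun u => (bond p kl u.1,
     val (r' (bond p m'l u.1)) k, clamp (3 * u.2 - 0))) _ gu).
    apply: ucon_pair; last exact: clampu.
    apply: ucon_pair.
      by apply: (ucon_comp fstu (bond_ucon rhoS kl setT)).
    apply: (ucon_comp fstu (g := fun x => val (r' (bond p m'l x)) k) _
              (fun _ _ => Logic.I)).
    exact: (ucon_comp (r'lu setT) (coord_ucon rhoS k setT)).
  move=> [x t] _ /=; split; last exact: clamp_itv.
  exact: lt_le_trans (close1 x) qk_eta.
have H2u : ucon (pdist (@rho l) (@rdist R)) D U
    (fun u => H2 u.1 (clamp (3 * u.2 - 2))).
  have [_ _ _ _ gu] := gamP.
  apply: (ucon_comp (f := fun u => (r' (bond p m'l u.1),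
     r (bond p mj (bond p jl u.1)), clamp (3 * u.2 - 2))) _ gu).
    apply: ucon_pair; last exact: clampu.
    apply: ucon_pair; first by apply: (ucon_comp fstu (r'lu setT)).
    by apply: rju; apply: (ucon_comp fstu (bond_ucon rhoS jl setT)).
  move=> [x t] _ /=; split; last exact: clamp_itv.
  exact: lt_le_trans (close2 x) q_eta.
pose h x t := if t <= 1 / 2 then H1 x (clamp (3 * t - 0))
              else val (H2 x (clamp (3 * t - 2))) k.
have [_ gam0 gam1 _ _] := gamP; have [_ gamk0 gamk1 _ _] := gamkP.
(* The homotopy rests at the common stage of its two halves for
   [1/3 <= t <= 2/3]. *)
have hE1 x t : t <= 2 / 3 -> h x t = H1 x (clamp (3 * t - 0)).
  move=> t2; rewrite /h; case: leP => // t1.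
  have c0 : clamp (3 * t - 2) = 0 by apply: clamp_le0; lra.
  have c1 : clamp (3 * t - 0) = 1 by apply: clamp_ge1; lra.
  by rewrite c0 c1 /H1 /H2 gam0 gamk1.
have hE2 x t : 1 / 3 <= t -> h x t = val (H2 x (clamp (3 * t - 2))) k.
  move=> t2; rewrite /h; case: leP => // t1.
  have c0 : clamp (3 * t - 2) = 0 by apply: clamp_le0; lra.
  have c1 : clamp (3 * t - 0) = 1 by apply: clamp_ge1; lra.
  by rewrite c0 c1 /H1 /H2 gam0 gamk1.
have [_ rC rT] := rP i.
exists l, ik, il, jl, kl, s, h; split.
- have idu : ucon (@rho j) (@rho j) setT id by exact: ucon_short.
  exact: (ucon_comp (rju _ _ _ _ idu) (coord_ucon rhoS k setT)).
- move=> x; rewrite bond_thread.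
  have [y xy] := hJ j mj (leq_maxr _ _) x; have h1 := rclose _ _ xy.
  have h2 := coord_le_lim_dist rhoS (r (bond p mj x)) y i.
  have h3 := bond_short rhoS im (bond p mj x) (val y m).
  rewrite bond_thread (bond_bond p im mj ij) in h3.
  have := rT (val (r (bond p mj x)) i) (val y i) (bond p ij x).
  by rewrite (rC (val y i)) => h4; rewrite -/D in h2; lra.
- apply: (@ucon_glue _ _ _ _ _ _ (fun u : X l * R => u.2) (1 / 3) (2 / 3)).
  + by lra.
  + by move=> x y; rewrite /pdist /rdist le_max lexx orbT.
  + apply: (ucon_eq (f := fun u => H1 u.1 (clamp (3 * u.2 - 0)))).
      by move=> [x t] [/= _ t1]; rewrite hE1.
    by apply: ucon_sub H1u => u [].
  + apply: (ucon_eq (f := fun u => val (H2 u.1 (clamp (3 * u.2 - 2))) k)).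
      by move=> [x t] [/= _ t1]; rewrite hE2.
    have H2u' : ucon (pdist (@rho l) (@rdist R)) D
      [set u : X l * R | U u /\ 1 / 3 <= u.2]
      (fun u => H2 u.1 (clamp (3 * u.2 - 2))) by apply: ucon_sub H2u => u [].
    exact: (ucon_comp H2u' (coord_ucon rhoS k setT)).
- have t0 : (0 : R) <= 2 / 3 by lra.
  have t1 : (1 / 3 : R) <= 1 by lra.
  have c0 : clamp (3 * 0 - 0 : R) = 0 by apply: clamp_le0; lra.
  have c1 : clamp (3 * 1 - 2 : R) = 1 by apply: clamp_ge1; lra.
  by move=> x; rewrite (hE1 x 0 t0) (hE2 x 1 t1) c0 c1 /H1 /H2 gamk0 gam1.
- move=> x t t01; rewrite /h; case: ifP => _.
    have := hqk _ _ _ (clamp_itv (3 * t - 0)) (close1 x).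
    have := bond_short rhoS ik (H1 x (clamp (3 * t - 0))) (bond p kl x).
    rewrite (bond_bond p ik kl il) -/(H1 x (clamp (3 * t - 0))) => h1 h2; lra.
  rewrite bond_thread; have := hq _ _ _ (clamp_itv (3 * t - 2)) (close2 x).
  rewrite -/(H2 x _); set z := H2 x _ => h1.
  have [y xy] := hl x; have h2 := r'close _ _ xy.
  have h3 := DT z (r' (bond p m'l x)) y.
  have h4 := coord_le_lim_dist rhoS z y i; rewrite -/D in h4.
  have h5 := down i im' il x y xy.
  by have := rT (val z i) (val y i) (bond p il x); rewrite (rC (val y i)) => h6; lra.
Qed.

End domination.

(** * The two implications *)

Section main.
Variables (R : realType) (X : nat -> metricType R).
Variable p : forall n, X n.+1 -> X n.
Hypothesis p_unif : forall n, unif_continuous (@p n).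
Hypothesis X_complete : forall n, complete_uniform (X n).
Hypothesis X_ANR : forall n, uniform_ANR R (X n).

Let d n : X n -> X n -> R := @mdist R (X n).
Let cd n : compatible_metric (@d n). Proof. exact: mdist_compatible. Qed.

Definition adapted_mdist n : X n -> X n -> R := adapted_dist p d (n := n).
Let rho n : X n -> X n -> R := @adapted_mdist n.

Let rhoS : short_bonds p rho.
Proof. exact: adapted_short_bonds. Qed.

Let cr n : compatible_metric (@rho n). Proof. by case: rhoS. Qed.

Let rc n : fast_complete (@rho n).
Proof. exact: complete_uniform_fast. Qed.

Let D := lim_dist (p := p) rho.
Let cD : compatible_metric D. Proof. exact: lim_dist_compatible rhoS. Qed.

Lemma inv_lim_fast_complete : fast_complete D.
Proof.
move=> u hu; have [|x hx] := almost_thread rhoS rc (v := fun n => val (u n) n).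
  move=> n; rewrite thread_p.
  have [[_ _ rC _] _] := cr n; rewrite rC.
  by apply: le_trans (hu n); exact: coord_le_lim_dist.
exists x => n; apply: (le_trans (lim_dist_max rhoS _ _ n)).
by have := half_pow_gt0 R n => h; rewrite ge_max hx/=; lra.
Qed.

Lemma compatible_metrics_equivalent (T : uniformType) (d1 d2 : T -> T -> R) :
  compatible_metric d1 -> compatible_metric d2 -> forall e, 0 < e ->
  exists2 q : R, 0 < q & forall x y, d1 x y <= q -> d2 x y <= e.
Proof.
move=> c1 c2 e e0.
have /(compatible_entourageP _ c1)[q q0 hq] :
    entourage [set xy : T * T | d2 xy.1 xy.2 < e].
  by apply/(compatible_entourageP _ c2); exists e.
exists (q / 2) => [|x y xy]; first by rewrite divr_gt0.
by apply/ltW; apply: hq; lra.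
Qed.

Definition homotopy_criterion (alpha : nat -> R) : Prop :=
  forall i : nat, exists (j : nat) (ij : (i <= j)%N),
    forall (k : nat) (jk : (j < k)%N),
    let ik : (i <= k)%N := leq_trans ij (ltnW jk) in
    exists (l : nat) (kl : (k <= l)%N) (s : X j -> X k),
    let jl : (j <= l)%N := leq_trans (ltnW jk) kl in
    let il : (i <= l)%N := leq_trans ik kl in
    [/\ unif_continuous s,
        close_maps (alpha i) (bond p ik \o s) (bond p ij)
      & exists h : X l * unit_interval R -> X k,
          uniform_homotopy (bond p kl) (s \o bond p jl) h /\
          close_maps (alpha i) (bond p ik \o h)
            (fun z : X l * unit_interval R => bond p il z.1)].

Let unit_dist (s t : unit_interval R) : R := rdist (val s) (val t).
Let cI : compatible_metric unit_dist.
Proof. exact: (subset_compatible _ (rdist_compatible R)). Qed.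

Let cXI l : compatible_metric (pdist (@rho l) unit_dist).
Proof. exact: pdist_compatible. Qed.

Lemma approx_dominated_criterion (a alpha : nat -> R) :
  (forall i x y, @rho i x y <= a i -> mdist x y <= alpha i) ->
  approx_dominated p rho a -> homotopy_criterion alpha.
Proof.
move=> aal dom i; have [j [ij hj]] := dom i; exists j, ij => k jk ik.
have [l [ik' [il [jl [kl [s [h [su sclose hu hends hclose]]]]]]]] := hj k jk.
exists l, kl, s => jl' il'; split.
- exact/(unif_continuous_uconP _ (cr j) (cr k)).
- by move=> x /=; apply: aal; rewrite (bool_irrelevance ik ik').
exists (fun z => h z.1 (val z.2)); split; last first.
  move=> z /=; apply: aal; rewrite (bool_irrelevance ik ik').
  by rewrite (bool_irrelevance il' il); apply: hclose; exact: set_valP z.2.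
split=> [|x t -> /=|x t -> /=]; last 2 first.
- by have [-> _] := hends x.
- by have [_ ->] := hends x; rewrite (bool_irrelevance jl' jl).
apply/(unif_continuous_uconP _ (cXI l) (cr k)).
apply: (ucon_comp (f := fun z => (z.1, val z.2)) (g := fun u => h u.1 u.2) _ hu).
  by apply: ucon_short => x y.
by move=> z _; exact: set_valP z.2.
Qed.

Lemma criterion_approx_dominated (a alpha : nat -> R) :
  (forall i x y, mdist x y <= alpha i -> @rho i x y <= a i) ->
  homotopy_criterion alpha -> approx_dominated p rho a.
Proof.
move=> ala crit i; have [j [ij hj]] := crit i; exists j, ij => k jk.
have [l [kl [s [su sclose [h [[hu h0 h1] hclose]]]]]] := hj k jk.
have ct (t : R) : clamp t \in [set t : R | 0 <= t <= 1].
  by apply: mem_set; exact: clamp_itv.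
pose cl t : unit_interval R := exist _ (clamp t) (ct t).
exists l, (leq_trans ij (ltnW jk)), (leq_trans (leq_trans ij (ltnW jk)) kl).
exists (leq_trans (ltnW jk) kl), kl, s, (fun x t => h (x, cl t)); split.
- exact/(unif_continuous_uconP _ (cr j) (cr k)).
- by move=> x; apply: ala; exact: sclose.
- apply: (ucon_comp (f := fun u => (u.1, cl u.2)) (g := h)
            (dU := pdist (@rho l) unit_dist) (B := setT)).
  + apply: ucon_short => x y; rewrite /pdist ge_max le_max lexx/=.
    by rewrite le_max (clamp_short x.2 y.2) orbT.
  + exact/(unif_continuous_uconP _ (cXI l) (cr k)).
  + by [].
- move=> x; split; first by apply: h0 => /=; rewrite clamp_le0.
  by apply: h1 => /=; rewrite clamp_ge1.
- by move=> x t _; apply: ala; exact: hclose (x, cl t).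
Qed.

Lemma empty_homotopy_criterion (alpha : nat -> R) (J : nat) :
  (forall j, (J <= j)%N -> X j -> False) -> homotopy_criterion alpha.
Proof.
move=> no i; exists (maxn i J), (leq_maxl i J) => k jk ik.
have noj : X (maxn i J) -> False by apply: no; exact: leq_maxr.
have nok : X k -> False.
  by apply: no; exact: leq_trans (leq_maxr i J) (ltnW jk).
exists k, (leqnn k), (fun x => False_rect _ (noj x)) => jl il; split.
- apply/(unif_continuous_uconP _ (cr _) (cr _)) => e e0.
  by exists 1 => // x; case: (noj x).
- by move=> x; case: (noj x).
exists (fun z => z.1); split; last by move=> -[x]; case: (nok x).
split=> [|x|x]; try by case: (nok x).
apply/(unif_continuous_uconP _ (cXI k) (cr k)) => e e0.
by exists 1 => // -[x]; case: (nok x).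
Qed.

Lemma ANR_homotopy_criterion (alpha : nat -> R) :
  convergent p R -> (forall i, 0 < alpha i) -> uniform_ANR R (inv_lim p) ->
  homotopy_criterion alpha.
Proof.
move=> conv alpha0 LA; have close := convergent_close cr conv.
(* If the limit is empty, convergence makes [X j] empty for all large [j]. *)
have [[x0 _]|no] := pselect (exists x : inv_lim p, True); last first.
  have [J hJ] := close 0%N 1 ltr01.
  apply: (@empty_homotopy_criterion _ J) => j Jj x.
  by have [y _] := hJ j (leq0n j) Jj x; apply: no; exists y.
have /choice[a aP] i : exists q : R, 0 < q /\
    forall x y, @rho i x y <= q -> mdist x y <= alpha i.
  have [q q0 hq] := compatible_metrics_equivalent (cr i) (cd i) (alpha0 i).
  by exists q.
apply: (@approx_dominated_criterion a).
  by move=> i; case: (aP i).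
apply: retract_approx_dominated => //.
- by move=> n; exact: ANR_kuratowski_retract (cr n) (val x0 n) (@rc n) (@X_ANR n).
- exact: ANR_kuratowski_retract cD x0 inv_lim_fast_complete LA.
- by move=> i; case: (aP i).
Qed.

Lemma empty_ANR (T : uniformType) : metrizable R T -> (T -> False) ->
  uniform_ANR R T.
Proof.
move=> Tm no; split=> // Z f [dZ cZ] _ _; exists set0.
  by exists dZ => //; exists 1 => // x y [u]; case: (no u).
have no' (u : set_type (set0 : set Z)) : False := set_valP u.
exists val; split=> u; try by case: (no' u).
move: u; apply/(unif_continuous_uconP _ (subset_compatible set0 cZ) cZ).
exact: ucon_short.
Qed.

Lemma approx_dominated_ANR :
  approx_dominated p rho (fun i => half_pow R i.+1) ->
  uniform_ANR R (inv_lim p).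
Proof.
move=> dom; have [[x0 _]|no] := pselect (exists x : inv_lim p, True); last first.
  apply: empty_ANR; first by exists D.
  by move=> x; apply: no; exists x.
split; first by exists D.
move=> Z f [dZ cZ] [finj fu fe] _.
have dZP := metric_pseudometric cZ.1; have [_ dC _] := dZP.
pose A := range f; have A0 : A !=set0 by exists (f x0), x0.
have /choice[g gP] (z : Z) : exists x : inv_lim p, A z -> f x = z.
  have [[x _ <-]|nz] := pselect (A z); first by exists x.
  by exists x0.
have gf x : g (f x) = x by apply: finj; apply: gP; exists x.
have gu : ucon dZ D A g.
  move=> e e0.
  have /fe[F /(compatible_entourageP _ cZ)[q q0 hq] hF] :
      entourage [set xy | D xy.1 xy.2 < e].
    by apply/(compatible_entourageP _ cD); exists e.
  exists q => // _ _ [x _ <-] [y _ <-] xy; rewrite !gf.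
  by apply: (hF x y); exact: hq.
have rho_retract n : kuratowski_retract (@rho n).
  exact: ANR_kuratowski_retract (cr n) (val x0 n) (@rc n) (@X_ANR n).
have [G [c [c0 GA Gu]]] := inv_lim_extension rhoS rho_retract dZP A0 gu rc dom.
exists [set z | set_dist dZ A z < c].
  exists dZ => //; exists c => // x y Ax xy.
  by apply: le_lt_trans (set_dist_le dZP y Ax) _; rewrite dC.
exists (fun u => f (G (val u))); split.
- apply/(unif_continuous_uconP _ (subset_compatible _ cZ) cZ).
  have /(unif_continuous_uconP _ cD cZ) fu' := fu.
  apply: (ucon_comp (f := G \o val) _ fu') => //.
  apply: (ucon_comp (ucon_short _ _) Gu) => [|u _]; first by [].
  exact: set_valP u.
- by move=> u; exists (G (val u)).
- by move=> u Au; rewrite GA// gP.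
Qed.

End main.

Theorem theorem18p2 (R : realType) (X : nat -> metricType R)
    (p : forall n, X n.+1 -> X n)
    (p_unif : forall n, unif_continuous (p n))
    (X_complete : forall n, complete_uniform (X n))
    (X_ANR : forall n, uniform_ANR R (X n))
    (X_conv : convergent p R) :
  exists alpha_star : nat -> R,
    (forall i, 0 < alpha_star i) /\
    forall alpha : nat -> R, (forall i, 0 < alpha i <= alpha_star i) ->
      (uniform_ANR R (inv_lim p)
       <->
       forall i : nat, exists (j : nat) (ij : (i <= j)%N),
         forall (k : nat) (jk : (j < k)%N),
         let ik : (i <= k)%N := leq_trans ij (ltnW jk) in
         exists (l : nat) (kl : (k <= l)%N) (s : X j -> X k),
         let jl : (j <= l)%N := leq_trans (ltnW jk) kl in
         let il : (i <= l)%N := leq_trans ik kl in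
         [/\ unif_continuous s,
             close_maps (alpha i) (bond p ik \o s) (bond p ij)
           & exists h : X l * unit_interval R -> X k,
               uniform_homotopy (bond p kl) (s \o bond p jl) h /\
               close_maps (alpha i) (bond p ik \o h)
                 (fun z : X l * unit_interval R => bond p il z.1)]).
Proof.
have cd n := mdist_compatible (X n).
have [cr _ _ _] := adapted_short_bonds cd p_unif.
have /choice[alpha_star starP] i : exists q : R, 0 < q /\
    forall x y : X i, mdist x y <= q -> adapted_mdist p x y <= half_pow R i.+1.
  have := compatible_metrics_equivalent (cd i) (cr i) (half_pow_gt0 R i.+1).
  by move=> [q q0 hq]; exists q.
exists alpha_star; split=> [i|alpha alphaP]; first by case: (starP i).
split.
  apply: ANR_homotopy_criterion => // i.
  by case/andP: (alphaP i).
move=> crit; apply: approx_dominated_ANR => //.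
apply: criterion_approx_dominated crit => // i x y xy.
have [_ h] := starP i; apply: h; apply: le_trans xy _.
by case/andP: (alphaP i).
Qed.
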